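(* For an oriented link $L$ in $\mathbb R^3$, $$K(L)=\sum_{i,j\in\mathbb Z}(-1)^i q^j\dim_{\mathbb Q}(\mathcal H^{i,j}(L)\otimes\mathbb Q),$$ where $K(L)$ is the scaled Kauffman bracket of $L$ and $\mathcal H^{i,j}(L)$ denotes the isomorphism class of $\mathcal H^{i,j}(D)$ for any plane diagram $D$ of $L$.
   Context: All tensor products are over $\mathbb Z$. For a graded abelian group $N$ let $N\{n\}_i=N_{i+n}$. For a complex $N$ let $N[n]^i=N^{i+n}$ with differential $(-1)^n d^{i+n}$. Let $\mathcal A$ be the free graded abelian group with basis $\mathbf{1},X$, $\deg(\mathbf 1)=1$, $\deg(X)=-1$; tensor powers carry the additive grading. Define $m:\mathcal A\otimes\mathcal A\to\mathcal A$, a commutative product with unit $\mathbf 1$ and $X^2=0$, and $\Delta:\mathcal A\to\mathcal A\otimes\mathcal A$, $\Delta(\mathbf 1)=\mathbf 1\otimes X+X\otimes\mathbf 1$, $\Delta(X)=X\otimes X$. Both have degree $-1$. A plane diagram $D$ is a generic plane projection (finitely many transverse double points, with over/under information). Each double point has two resolutions: the $0$-resolution joins the two regions swept out by rotating the overstrand counterclockwise until it meets the understrand; the $1$-resolution is the other smoothing. For an oriented diagram, $y(D)$ is the number of positive crossings (those whose $0$-resolution is compatible with the orientation) and $x(D)$ is the number of negative crossings (those whose $1$-resolution is compatible with the orientation). Scaled Kauffman bracket: $\langle D\rangle\in\mathbb Z[q,q^{-1}]$ is determined by: a simple closed loop evaluates to $q+q^{-1}$; $\langle D_1\rangle=\langle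 D_2\rangle-q\langle D_3\rangle$ whenever $D_2$, $D_3$ are obtained from $D_1$ by the $0$-resolution, respectively $1$-resolution, of one double point; and $\langle D_1\sqcup D_2\rangle=\langle D_1\rangle\langle D_2\rangle$. Put $K(D)=(-1)^{x(D)}q^{y(D)-2x(D)}\langle D\rangle$; it depends only on $L$ and is denoted $K(L)$. Let $\mathcal I$ be the set of double points of $D$. For $\mathcal L\subset\mathcal I$ let $D(\mathcal L)$ be the collection of disjoint simple closed curves obtained by taking the $1$-resolution at points of $\mathcal L$ and the $0$-resolution at the other points. Put $\mathcal V_D(\mathcal L)=\mathcal A^{\otimes k}\{-|\mathcal L|\}$, with tensor factors indexed by the $k$ circles of $D(\mathcal L)$. For $a\in\mathcal I\setminus\mathcal L$, passing from $D(\mathcal L)$ to $D(\mathcal L\cup\{a\})$ either merges two circles or splits one circle into two; let $\xi_a(\mathcal L):\mathcal V_D(\mathcal L)\to\mathcal V_D(\mathcal L\cup\{a\})$ be $m$, respectively $\Delta$, on the corresponding factors and the identity on the other factors (a grading-preserving map). Fix a total order on $\mathcal I$ (different orders give isomorphic complexes). Let $\overline{\mathcal C}(D)$ be the complex of graded abelian groups with $\overline{\mathcal C}^i(D)=\bigoplus_{|\mathcal L|=i}\mathcal V_D(\mathcal L)$ and differential $d(v)=\sum_{a\in\mathcal I\setminus\mathcal L}(-1)^{\#\{b\in\mathcal L:\,b>a\}}\xi_a(\mathcal L)(v)$ for $v\in\mathcal V_D(\mathcal L)$. Put $\mathcal C(D)=\overline{\mathcal C}(D)[x(D)]\{2x(D)-y(D)\}$,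 and let $\mathcal H^{i,j}(D)$ be the $i$-th cohomology group of the $j$-th graded summand of $\mathcal C(D)$; only finitely many of these groups are non-zero, and their isomorphism classes depend only on $L$. *)

(* Defs.v *)
From HB Require Import structures.
From mathcomp Require Import all_boot all_order all_algebra.
From mathcomp Require Import generic_quotient ring_quotient.
From mathcomp Require Import boolp.

Set Implicit Arguments.
Unset Strict Implicit.
Unset Printing Implicit Defensive.

Import GRing.Theory.
Local Open Scope ring_scope.

(* A generic projection is encoded by its planar combinatorial map: the plane
   curve is cut at its double points and at finitely many auxiliary marked
   points of its arcs, at least one on every closed curve without double
   point, and the resulting edges are split into two half-edges (darts) each.
   [edge] exchanges the two halves of an edge, and [rot] is the
   counterclockwise rotation of the darts about their common endpoint.  The
   relative position of the connected components of the curve (nesting) is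
   not recorded: resolutions and their circles do not depend on it.  Marked
   points make resolving a double point an operation with the same darts. *)

Record prediagram := Prediagram {
  dart : finType;
  edge : dart -> dart;
  rot : dart -> dart;
  over : pred dart (* only meaningful on darts at double points *)
}.

Arguments edge {p}.
Arguments rot {p}.
Arguments over {p}.

(* The endpoint of [x] is a double point (rather than a marked point). *)
Definition at_crossing (D : prediagram) (x : dart D) : bool :=
  rot (rot x) != x.

Definition glink (D : prediagram) : rel (dart D) :=
  [rel x y | (y == edge x) || (y == rot x)].

(* [rot] has orbits of size 2 (marked points) and 4 (double points, where the
   two strands are {x, rot^2 x} and {rot x, rot^3 x}).  The orbits of
   [rot \o edge] are the faces, so [diagram_planar] is Euler's formula
   V + F = E + 2C, i.e. the map has genus 0. *)
Record is_diagram (D : prediagram) : Prop := IsDiagram {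
  diagram_edgeK : involutive (@edge D);
  diagram_edge_neq : forall x : dart D, edge x != x;
  diagram_rot4 : forall x : dart D, rot (rot (rot (rot x))) = x;
  diagram_rot_neq : forall x : dart D, rot x != x;
  diagram_over : forall x : dart D, at_crossing x -> over (rot x) = ~~ over x;
  diagram_planar :
    (fcard (@rot D) {: dart D} + fcard (@rot D \o @edge D) {: dart D}
     = fcard (@edge D) {: dart D} + 2 * n_comp (@glink D) {: dart D})%N
}.

Record diagram := Diagram {
  diagram_pre :> prediagram;
  diagramP : is_diagram diagram_pre
}.

Definition isomorphic (D E : prediagram) : Prop :=
  exists f : dart D -> dart E,
    [/\ bijective f,
        forall x, f (edge x) = edge (f x),
        forall x, f (rot x) = rot (f x)
      & forall x, at_crossing x -> over (f x) = over x].

(* A double point is represented by the canonical dart of its [rot]-orbit. *)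
Definition crossing (D : prediagram) : finType :=
  {x : dart D | at_crossing x && (froot rot x == x)}.

Definition incident (D : prediagram) (c : crossing D) (x : dart D) : bool :=
  fconnect rot (val c) x.

(* The dart to which [x] is joined at its double point by the 0-resolution
   ([b = false]) or the 1-resolution ([b = true]).  Rotating the overstrand
   counterclockwise sweeps out the corners between x and [rot x] for x over,
   and the 0-resolution joins these two regions; its arcs therefore run in the
   other two corners and connect the overdart x to rot^-1 x = rot^3 x. *)
Definition partner (D : prediagram) (b : bool) (x : dart D) : dart D :=
  if over x (+) b then rot (rot (rot x)) else rot x.

(* The double point [c] is replaced by two marked points. *)
Definition resolution (D : prediagram) (c : crossing D) (b : bool) :
    prediagram :=
  @Prediagram (dart D) edge
    (fun x => if incident c x then partner b x else rot x) over.

Definition disjoint_union (D E : prediagram) : prediagram :=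
  @Prediagram (dart D + dart E)%type
    (fun x => match x with inl y => inl (edge y) | inr y => inr (edge y) end)
    (fun x => match x with inl y => inl (rot y) | inr y => inr (rot y) end)
    (fun x => match x with inl y => over y | inr y => over y end).

Definition is_loop (D : prediagram) : Prop :=
  n_comp (@glink D) {: dart D} = 1%N /\ forall x : dart D, ~~ at_crossing x.

(* [out x]: the orientation points along [x] away from its endpoint. *)
Record oriented_diagram := OrientedDiagram {
  oriented_diagram_diagram :> diagram;
  out : pred (dart oriented_diagram_diagram);
  out_edge : forall x, out (edge x) = ~~ out x;
  out_mark : forall x, ~~ at_crossing x -> out (rot x) = ~~ out x;
  out_crossing : forall x, at_crossing x -> out (rot (rot x)) = ~~ out x
}.

Definition compatible (D : oriented_diagram) (c : crossing D) (b : bool) :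
    bool :=
  [forall x : dart D, incident c x ==> (out (partner b x) != out x)].

Definition npos (D : oriented_diagram) : nat :=
  #|[set c : crossing D | compatible c false]|.

Definition nneg (D : oriented_diagram) : nat :=
  #|[set c : crossing D | compatible c true]|.

(* Z[q, q^-1] is taken inside its field of fractions Z(q). *)
Definition qfrac : fieldType := {fraction {poly int}}.
Definition q : qfrac := tofrac 'X.

Definition is_laurent (z : qfrac) : Prop :=
  exists (p : {poly int}) (n : nat), z = tofrac p / q ^+ n.

(* In [bracket_skein], [D2] and [D3] are diagrams for the two resolutions of
   [D1] at [c], up to isomorphism. *)
Record is_kauffman_bracket (br : diagram -> qfrac) : Prop := IsKauffmanBracket {
  bracket_laurent : forall D, is_laurent (br D);
  bracket_loop : forall D : diagram, is_loop D -> br D = q + q^-1;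
  bracket_skein : forall (D1 D2 D3 : diagram) (c : crossing D1),
    isomorphic D2 (resolution c false) -> isomorphic D3 (resolution c true) ->
    br D1 = br D2 - q * br D3;
  bracket_disjoint_union : forall D1 D2 D : diagram,
    isomorphic D (disjoint_union D1 D2) -> br D = br D1 * br D2
}.

Definition scaled_bracket (br : diagram -> qfrac) (D : oriented_diagram) :
    qfrac :=
  (-1) ^+ nneg D * q ^ ((npos D)%:Z - (2 * nneg D)%:Z) * br D.

(* The basis vector 1 of A is [true] and X is [false]. *)

Notation gen := bool (only parsing).
Definition one_gen : gen := true.
Definition X_gen : gen := false.

Definition gen_deg (g : gen) : int := if g then 1 else -1.

(* Products and coproducts of basis vectors, as lists of basis vectors to be
   summed. *)
Definition mult (g h : gen) : seq gen :=
  match g, h with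
  | true, _ => [:: h]
  | _, true => [:: g]
  | false, false => [::]
  end.

Definition comult (g : gen) : seq (gen * gen) :=
  if g then [:: (one_gen, X_gen); (X_gen, one_gen)] else [:: (X_gen, X_gen)].

Section Cube.

Context {D : prediagram}.

(* A state is the set of double points at which the 1-resolution is taken. *)
Implicit Types (s t : {set crossing D}) (a b : crossing D).

Definition resolve s (x : dart D) : dart D :=
  if at_crossing x then partner [exists c in s, incident c x] x else rot x.

Definition strand s : rel (dart D) :=
  [rel x y | (y == edge x) || (y == resolve s x)].

Definition circles s : {set {set dart D}} :=
  [set [set y | connect (strand s) x y] | x : dart D].

Definition circle s : finType := {C : {set dart D} | C \in circles s}.

Lemma circle_of_subproof s (x : dart D) :
  [set y | connect (strand s) x y] \in circles s.
Proof. exact: imset_f. Qed.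

Definition circle_of s (x : dart D) : circle s :=
  exist (fun C => C \in circles s) _ (circle_of_subproof s x).

(* Basis of the tensor power of A with factors indexed by the circles. *)
Definition labelling s : finType := {ffun circle s -> gen}.

(* Matrix entry of xi_a(s) : V(s) -> V(t), for t = a |: s, at the basis vectors
   [l] and [l'].  The darts [val a] and rot^2 (val a) lie on the two arcs of
   the resolution of [a], in D(s) as well as in D(t); a circle not through [a]
   is a circle of both D(s) and D(t), with the same darts. *)
Definition xi_coef a s t (l : labelling s) (l' : labelling t) : int :=
  let x := val a in
  let y := rot (rot (val a)) in
  let same_on_others :=
    [forall z, [&& z \notin val (circle_of s x) & z \notin val (circle_of s y)]
       ==> (l (circle_of s z) == l' (circle_of t z))] in
  if ~~ same_on_others then 0
  else if circle_of s x != circle_of s y then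
    (count_mem (l' (circle_of t x))
       (mult (l (circle_of s x)) (l (circle_of s y))))%:Z
  else if circle_of t x != circle_of t y then
    (count_mem (l' (circle_of t x), l' (circle_of t y))
       (comult (l (circle_of s x))))%:Z
  else 0 (* excluded by planarity *).

(* Basis of the direct sum of the V(s). *)
Definition generator : finType := {s : {set crossing D} & labelling s}.

Definition height (g : generator) : int := #|tag g|.

(* A{n} has A{n}_i = A_(i+n), whence the shift by +|s| for A{-|s|}. *)
Definition degree (g : generator) : int :=
  \sum_(C : circle (tag g)) gen_deg (tagged g C) + #|tag g|%:Z.

(* [le] is the chosen total order on the double points. *)
Definition diff_coef (le : rel (crossing D)) (g g' : generator) : int :=
  \sum_(a | (a \notin tag g) && (tag g' == a |: tag g))
    (-1) ^+ #|[set b in tag g | (b != a) && le a b]|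
      * xi_coef a (tagged g) (tagged g').

Definition cube_basis (i j : int) : finType :=
  {g : generator | (height g == i) && (degree g == j)}.

Definition cube_cochain (i j : int) : zmodType := {ffun cube_basis i j -> int}.

(* The component of the differential from degree [i] to degree [k]; it is
   used for k = i + 1 only. *)
Definition cube_diff (le : rel (crossing D)) (i k j : int)
    (v : {ffun cube_basis i j -> int}) : {ffun cube_basis k j -> int} :=
  [ffun g' => \sum_g diff_coef le (val g) (val g') * v g].

End Cube.

Arguments generator D : clear implicits.
Arguments cube_cochain D i j : clear implicits.

(* C(D) = Cbar(D)[x(D)]{2x(D)-y(D)} *)
Definition cochain (D : oriented_diagram) (i j : int) : zmodType :=
  cube_cochain D (i + (nneg D)%:Z) (j + ((2 * nneg D)%:Z - (npos D)%:Z)).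

Definition differential (D : oriented_diagram) (le : rel (crossing D))
    (i k j : int) (v : cochain D i j) : cochain D k j :=
  (cube_diff le (k + (nneg D)%:Z) v : cube_cochain D _ _) *~ (-1) ^+ nneg D.

Lemma differential_is_zmod_morphism D le i k j :
  zmod_morphism (@differential D le i k j).
Proof.
move=> v w; rewrite /differential -mulrzBl; congr (_ *~ _).
apply/ffunP=> g; rewrite !ffunE -sumrB; apply: eq_bigr => h _.
by rewrite !ffunE -mulrBr.
Qed.

HB.instance Definition _ D le i k j :=
  GRing.isZmodMorphism.Build _ _ (@differential D le i k j)
    (@differential_is_zmod_morphism D le i k j).

Section Cohomology.

Context {U V W : zmodType} (f : {additive U -> V}) (g : {additive V -> W}).

Definition is_cocycle : {pred V} := fun v => g v == 0.

Lemma is_cocycle_zmod : zmod_closed is_cocycle.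
Proof.
split=> [|v w]; rewrite !unfold_in ?raddf0 // => /eqP gv /eqP gw.
by rewrite raddfB gv gw subrr.
Qed.

HB.instance Definition _ := GRing.isZmodClosed.Build V is_cocycle
  is_cocycle_zmod.

Record cocycle := Cocycle { cocycle_val : V; _ : cocycle_val \in is_cocycle }.

HB.instance Definition _ := [isSub for cocycle_val].
HB.instance Definition _ := [Choice of cocycle by <:].
HB.instance Definition _ := [SubChoice_isSubZmodule of cocycle by <:].

(* When [g \o f] = 0 this is the whole image of f, seen inside ker g. *)
Definition is_coboundary : {pred cocycle} :=
  fun z => `[< exists u, f u = val z >].

Lemma is_coboundary_zmod : zmod_closed is_coboundary.
Proof.
split=> [|z w]; rewrite !unfold_in.
  by apply/asboolP; exists 0; rewrite raddf0.
move=> /asboolP[u fu] /asboolP[u' fu']; apply/asboolP; exists (u - u').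
by rewrite raddfB fu fu' raddfB.
Qed.

HB.instance Definition _ := GRing.isZmodClosed.Build cocycle is_coboundary
  is_coboundary_zmod.

Definition cohomology : zmodType := Quotient.quot is_coboundary.

End Cohomology.

Definition Khovanov (D : oriented_diagram) (le : rel (crossing D)) (i j : int) :
    zmodType :=
  cohomology (@differential D le (i - 1) i j) (@differential D le i (i + 1) j).

Definition biadditive (G H A : zmodType) (b : G -> H -> A) : Prop :=
  (forall x, zmod_morphism (b x)) /\ (forall y, zmod_morphism (b^~ y)).

(* The rational vector space [W], with x \otimes r := t x r, is the tensor
   product over Z of [G] and Q. *)
Record is_tensorQ (G : zmodType) (W : vectType rat) (t : G -> rat -> W) : Prop :=
  IsTensorQ {
  tensorQ_biadditive : biadditive t;
  tensorQ_scale : forall x (r r' : rat), r *: t x r' = t x (r * r');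
  tensorQ_universal : forall (A : zmodType) (b : G -> rat -> A), biadditive b ->
    exists2 h : {additive W -> A}, (forall x r, h (t x r) = b x r)
      & forall h' : {additive W -> A}, (forall x r, h' (t x r) = b x r) ->
          h' =1 h
}.

(* Main.v *)
Require Import Defs.
From HB Require Import structures.
From mathcomp Require Import all_boot all_order all_algebra all_fingroup.
From mathcomp Require Import generic_quotient ring_quotient boolp.
From mathcomp Require Import zify.

Set Implicit Arguments.
Unset Strict Implicit.
Unset Printing Implicit Defensive.

Import Defs GRing.Theory.

(** Both sides are equal to the state sum
      (-1)^x q^(y-2x) sum_s (-q)^|s| (q + q^-1)^(number of circles of D(s)),
    over the sets s of double points; here x and y are the numbers of negative
    and positive crossings.

    The bracket: the skein relation, applied to one double point after the
    other, expands the bracket of D into the brackets of its resolutions D(s),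
    and a diagram without double point is a disjoint union of loops, to which
    multiplicativity applies ([bracket_state_sum], [bracket_crossing_free]).
    The skein relation speaks of diagrams only, so every partial resolution of D
    has to be a planar map.  This is [split_vertex]: resolving a double point
    splits a vertex in two, which changes the number of faces by one; that the
    change has the sign required by Euler's formula follows from the inequality
    V + F <= E + 2C, valid on every surface ([genus_ge0]).

    The cohomology: the Euler characteristic of a complex is that of its
    cohomology.  Over the rationals, the universal property identifies the
    tensor product with the kernel of the differential modulo the image of the
    preceding one ([cohomology_dim]), and the ranks of the differentials cancel in
    the alternating sum ([euler_characteristic]).  The graded dimension of the
    complex itself is the state sum, because the tensor power of A over k circles
    has graded dimension (q + q^-1)^k ([graded_dimension]).

    It remains to see that the cube is a complex ([diff_coef_sq]), that is, that
    its square faces commute.  Planarity provides a checkerboard colouring of the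
    regions ([diagram_checkerboard]), which orients the circles of all the states
    coherently, so that a change of resolution merges two circles or splits one
    ([surgery_connect]).  The module V(s) is the quotient of the polynomial ring
    Z[X_z], z running over the darts, by the relations X_z = X_w for z and w on
    the same circle, and X_z^2 = 0.  The edge maps are linear over this
    ring ([xi_X_linear]) and V(s) is generated by 1, hence a composite of two edge
    maps is determined by the image of 1.  A merge sends 1 to 1 and a split at a
    sends it to X_a + X_a', with a and a' on the two arcs at this double point.
    On each of the two paths around a square the image of 1 is the product of
    these factors.  The two paths have as many splits; when these occur at different
    double points, the pairs of circles concerned in the final state
    coincide ([delta1_swap_split], [delta1_swap_merge]), and so do the
    products. *)

(** * Classes of a relation, and gluing two of them *)

Section Classes.
Variable T : finType.
Implicit Types (e R : rel T) (f g : T -> T).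

Definition classes e : {set {set T}} := [set [set y | connect e x y] | x : T].

Lemma connect_least e R : reflexive R -> transitive R -> subrel e R ->
  subrel (connect e) R.
Proof.
move=> Rxx Rtr sub x y /connectP[p]; elim: p x => [|z p IH] x /=.
  by move=> _ ->.
by case/andP=> /sub xz /IH h /h; apply: Rtr.
Qed.

Lemma eq_classes e e' : connect e =2 connect e' -> classes e = classes e'.
Proof.
by move=> E; apply: eq_imset => x; apply/setP=> y; rewrite !inE E.
Qed.

Lemma eq_class e x y : connect_sym e ->
  ([set z | connect e x z] == [set z | connect e y z]) = connect e x y.
Proof.
move=> sym; apply/eqP/idP => [/setP/(_ y)|xy]; first by rewrite !inE connect0.
by apply/setP=> z; rewrite !inE (same_connect sym xy).
Qed.

Lemma card_classes e : connect_sym e -> #|classes e| = n_comp e T.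
Proof.
move=> sym; have -> : classes e = [set [set y | connect e x y] | x in roots e].
  apply/setP=> C; apply/imsetP/imsetP=> -[x _ ->]; last by exists x.
  exists (fingraph.root e x); first exact: roots_root.
  by apply/eqP; rewrite eq_class ?connect_root.
rewrite card_in_imset; first by apply: eq_card => x; rewrite !inE andbT.
move=> x y /eqP rx /eqP ry /eqP.
by rewrite eq_class // -{2}rx -{2}ry => /(fingraph.rootP sym).
Qed.

Lemma porbit_fconnect (p : {perm T}) x y : (y \in porbit p x) = fconnect p x y.
Proof.
apply/porbitP/idP => [[i ->]|/iter_findex <-].
  by rewrite permX fconnect_iter.
by exists (findex p x y); rewrite permX.
Qed.

Lemma classes_porbits (p : {perm T}) : classes (frel p) = porbits p.
Proof.
by apply: eq_imset => x; apply/setP=> y; rewrite inE porbit_fconnect.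
Qed.

Definition link f g : rel T := [rel x y | (y == f x) || (y == g x)].

Lemma link_sym f g : injective f -> injective g -> connect_sym (link f g).
Proof.
move=> If Ig; suff sub x y : connect (link f g) x y -> connect (link f g) y x.
  by move=> x y; apply/idP/idP; apply: sub.
move: x y; apply: connect_least => [x|y x z xy yz|x y].
- exact: connect0.
- exact: connect_trans yz xy.
have step h : injective h -> subrel (frel h) (link f g) ->
    connect (link f g) (h x) x.
  move=> Ih sub; have: fconnect h (h x) x by rewrite fconnect_sym ?fconnect1.
  by apply: connect_sub => u v /sub uv; apply: connect1.
case/orP=> /eqP->; apply: step => //; move=> u v /eqP<-.
  by rewrite /link /= eqxx.
by rewrite /link /= eqxx orbT.
Qed.

Lemma connect_link1 f g x : connect (link f g) x (f x).
Proof. by apply: connect1; rewrite /link /= eqxx. Qed.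

Lemma connect_link2 f g x : connect (link f g) x (g x).
Proof. by apply: connect1; rewrite /link /= eqxx orbT. Qed.

Lemma connect_link_least f g (R : rel T) : reflexive R -> transitive R ->
  (forall x, R x (f x)) -> (forall x, R x (g x)) ->
  subrel (connect (link f g)) R.
Proof.
move=> Rxx Rtr Rf Rg; apply: connect_least => // x y.
by case/orP=> /eqP->.
Qed.

Lemma eq_link f g f' g' : f =1 f' -> g =1 g' -> link f g =2 link f' g'.
Proof. by move=> ff gg x y; rewrite /link /= ff gg. Qed.

Definition near e x y u := connect e x u || connect e y u.

Definition glued e e' x y := forall u v,
  connect e' u v = connect e u v || near e x y u && near e x y v.

Lemma near_connect e x y u v : connect_sym e -> connect e u v ->
  near e x y u = near e x y v.
Proof. by move=> sym uv; rewrite /near !(same_connect_r sym uv). Qed.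

(** The hypotheses bear on single steps: a step of e' may leave a class of e only
    between the classes of x and y. *)
Lemma glued_link e e' x y : connect_sym e -> connect_sym e' ->
  subrel e (connect e') -> connect e' x y ->
  (forall u v, e' u v -> connect e u v || near e x y u && near e x y v) ->
  glued e e' x y.
Proof.
move=> sym sym' sub xy lk.
have sub' : subrel (connect e) (connect e').
  by apply: connect_sub.
have nx u : near e x y u -> connect e' x u.
  by case/orP=> /sub' //; apply: connect_trans.
move=> u v; apply/idP/idP; last first.
  case/orP=> [/sub'//|/andP[/nx xu /nx]]; apply: connect_trans.
  by rewrite sym'.
move: u v; apply: connect_least => // [u|v u w]; first by rewrite /= connect0.
case/orP=> [uv|/andP[nu nv]].
  by rewrite -(near_connect _ _ sym uv) (same_connect sym uv).
case/orP=> [vw|/andP[_ ->]]; last by rewrite nu orbT.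
by rewrite -(near_connect _ _ sym vw) nu nv orbT.
Qed.

(** The classes that survive when x and y are linked. *)
Definition far_classes e x y : {set {set T}} :=
  [set C in classes e | (x \notin C) && (y \notin C)].

Lemma classesD e x y : connect_sym e -> classes e =
  [set z | connect e x z] |: ([set z | connect e y z] |: far_classes e x y).
Proof.
move=> sym; apply/setP=> C; rewrite !inE.
apply/idP/idP => [Ce|]; last first.
  by case/or3P=> [/eqP->|/eqP->|/andP[]//]; apply: imset_f.
rewrite Ce /=; case/imsetP: Ce => z _ ->; rewrite !eq_class // !inE.
by do 2!case: (connect e z _).
Qed.

Lemma far_classes_glued e e' x y : connect_sym e -> glued e e' x y ->
  far_classes e' x y = far_classes e x y.
Proof.
move=> sym gl.
have same z : ~~ connect e z x -> ~~ connect e z y ->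
    [set w | connect e' z w] = [set w | connect e z w].
  move=> zx zy; apply/setP=> w; rewrite !inE gl /near.
  by rewrite (sym x z) (sym y z) (negPf zx) (negPf zy) /= orbF.
apply/setP=> C; rewrite !inE; apply/andP/andP.
  case=> /imsetP[z _ ->]; rewrite !inE !gl /near !connect0 orbT !andbT.
  rewrite (sym x z) (sym y z) !negb_or => /andP[/and3P[zx _ zy] _].
  by rewrite same // zx zy; split=> //; apply: imset_f.
case=> /imsetP[z _ ->]; rewrite !inE => /andP[zx zy].
by rewrite zx zy -same //; split=> //; apply: imset_f.
Qed.

Lemma card_classesD e x y : connect_sym e ->
  #|classes e| = (#|far_classes e x y| + (~~ connect e x y) + 1)%N.
Proof.
move=> sym; rewrite {1}(classesD x y sym) !cardsU1 !inE eq_class //.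
by rewrite !connect0 !andbF /= orbF; lia.
Qed.

Lemma card_classes_glued e e' x y : connect_sym e -> connect_sym e' ->
  glued e e' x y -> #|classes e| = (#|classes e'| + ~~ connect e x y)%N.
Proof.
move=> sym sym' gl.
rewrite (card_classesD x y sym) (card_classesD x y sym').
by rewrite (far_classes_glued sym gl) gl /near !connect0 !orbT /=; lia.
Qed.

End Classes.

(** * The genus of a combinatorial map *)

Section Genus.
Variable T : finType.
Implicit Types (e r : {perm T}) (x y : T).

Lemma perm_link_sym e r : connect_sym (link e r).
Proof. by apply: link_sym; apply: perm_inj. Qed.

Lemma card_porbits1 : #|porbits (1 : {perm T})%g| = #|T|.
Proof.
rewrite -classes_porbits card_classes; last exact: fconnect_sym perm_inj.
rewrite -(fcard_id T); apply: eq_n_comp => x y.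
by apply: eq_connect => u v; rewrite /= perm1.
Qed.

(** Twice the genus of a hypermap, |T| + 2C - V - E - F, is nonnegative.  The
    permutation e is built up from the identity by transpositions.  Each of them
    merges two cycles of e and changes the number of cycles of e * r by one; if it
    connects two components, it also merges two cycles of e * r. *)
Lemma genus_ge0 e r :
  #|porbits r| + #|porbits (e * r)%g| + #|porbits e|
    <= #|T| + 2 * #|classes (link e r)|.
Proof.
have [n] := ubnP #|[set x | e x != x]|; elim: n e => // n IH e.
rewrite ltnS => le_n.
have [x ex|id_e] := pickP (fun x => e x != x); last first.
  have -> : e = 1%g by apply/permP=> x; rewrite perm1; apply/eqP/negbFE/id_e.
  rewrite mul1g card_porbits1.
  suff -> : classes (link (1 : {perm T})%g r) = porbits r.
    by rewrite mul2n -addnn addnC.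
  rewrite -classes_porbits; apply: eq_classes => x y; apply/idP/idP.
    move: x y; apply: connect_link_least => [x|y x z|x|x] //.
    - exact: connect_trans.
    - by rewrite perm1.
    - exact: fconnect1.
  by apply: connect_sub => u v /eqP <-; apply: connect_link2.
(* The permutation e' fixes x in addition to the fixed points of e. *)
pose y := (e^-1)%g x; pose e' := (tperm x y * e)%g.
have ey : e y = x by rewrite /y permKV.
have xy : x != y by apply: contraNneq ex => {1}->; rewrite ey.
have e'x : e' x = x by rewrite permM tpermL.
have e'y : e' y = e x by rewrite permM tpermR.
have e'D z : z != x -> z != y -> e' z = e z.
  by move=> zx zy; rewrite permM tpermD // eq_sym.
have eE : e = (tperm x y * e')%g by rewrite mulgA tperm2 mul1g.
have lt_n : #|[set z | e' z != z]| < n.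
  apply: leq_trans le_n; apply: proper_card; apply/properP; split.
    apply/subsetP=> z; rewrite !inE; apply: contra => /eqP ez.
    have [->|zx] := eqVneq z x; first by rewrite e'x.
    have [zy|zy] := eqVneq z y; last by rewrite e'D // ez.
    by move: zx; rewrite -[z]ez zy ey eqxx.
  by exists x; rewrite inE ?e'x ?eqxx.
have := IH _ lt_n; move: (porbits_mul_tperm e x y) => /=.
rewrite -/e' xy /=; have -> : x \in porbit e y 
  by rewrite porbit_fconnect; apply: connect1; rewrite /= ey.
have eM : (e * r = tperm x y * (e' * r))%g by rewrite {1}eE !mulgA.
move: (porbits_mul_tperm (e' * r)%g x y) => /=; rewrite -eM xy.
have sym := perm_link_sym e r; have sym' := perm_link_sym e' r.
have lnk : glued (link e' r) (link e r) x y.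
  apply: glued_link => //.
  - move=> u v /orP[]/eqP->; last exact: connect_link2.
    have [->|ux] := eqVneq u x; first by rewrite e'x.
    have [->|uy] := eqVneq u y; last by rewrite e'D //; apply: connect_link1.
    rewrite e'y; apply: connect_trans (connect_link1 _ _ _).
    by apply: connect1; rewrite /link /= ey eqxx.
  - by rewrite sym; apply: connect1; rewrite /link /= ey eqxx.
  move=> u v /orP[]/eqP->; last by rewrite connect_link2.
  have [->|ux] := eqVneq u x.
    by rewrite /near -e'y connect_link1 connect0 !orbT.
  have [->|uy] := eqVneq u y; first by rewrite ey /near !connect0 !orbT.
  by rewrite -e'D // connect_link1.
rewrite (card_classes_glued sym' sym lnk).
have imp : (x \in porbit (e' * r)%g y) -> connect (link e' r) x y.
  rewrite porbit_fconnect sym'; apply: connect_sub => u v /eqP <-.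
  by rewrite permM; apply: connect_trans (connect_link1 _ _ _) (connect_link2 _ _ _).
move: #|classes _| #|porbits r| #|porbits (e * r)%g| #|porbits (e' * r)%g|.
move: #|porbits e| #|porbits e'| #|T| => ? ? ? ? ? ? ?.
by move: imp; case: (connect _ x y); case: (_ \in _) => /= imp; lia.
Qed.
End Genus.

Section Surgery.
Variables (T : finType) (e : T -> T).
Hypotheses (eK : involutive e) (e_neq : forall x, e x != x).
Implicit Types (r : T -> T) (x y : T).

Lemma classes_perm r (Ir : injective r) : classes (frel r) = porbits (perm Ir).
Proof.
rewrite -classes_porbits; apply: eq_classes => x y.
by apply: eq_connect => u v; rewrite /= permE.
Qed.

Lemma fconnect_invol x y : fconnect e x y = (y == x) || (y == e x).
Proof.
apply/idP/orP => [|[/eqP->|/eqP->]]; rewrite ?connect0 ?fconnect1 //.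
move/iter_findex <-; elim: (findex _ _ _) => [|n]; first by left.
by case=> /eqP /= ->; [right | left; rewrite eK].
Qed.

Lemma card_edges : (2 * #|classes (frel e)|)%N = #|T|.
Proof.
rewrite card_classes; last exact/fconnect_sym/inv_inj.
rewrite mulnC; apply: (@fcard_order_set _ e (inv_inj eK) 2 T) => //.
apply/subsetP=> x _; rewrite inE.
have -> : fingraph.order e x = #|pred2 x (e x)|.
  by apply: eq_card => y; rewrite !inE; apply: fconnect_invol.
by rewrite card2 (eq_sym x) e_neq.
Qed.

Lemma genus_fun_ge0 r : injective r ->
  #|classes (frel r)| + #|classes (frel (r \o e))|
    <= #|classes (frel e)| + 2 * #|classes (link e r)|.
Proof.
move=> Ir; have Ie := inv_inj eK; have Ire := inj_comp Ir Ie.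
have := genus_ge0 (perm Ie) (perm Ir).
have -> : (perm Ie * perm Ir)%g = perm Ire.
  by apply/permP=> x; rewrite permM !permE.
rewrite -!classes_perm -card_edges.
have -> : classes (link (perm Ie) (perm Ir)) = classes (link e r).
  by apply: eq_classes; apply: eq_connect; apply: eq_link; apply: permE.
move: #|classes (link _ _)| #|classes (frel e)| #|classes (frel r)| => a b c.
by move: #|classes _| => d; lia.
Qed.

(** Euler's formula for a sphere in each component: V + F = E + 2C. *)
Definition planar r := #|classes (frel r)| + #|classes (frel (r \o e))| =
  #|classes (frel e)| + 2 * #|classes (link e r)|.

Section SplitVertex.
Variables (r r' : T -> T) (x y : T).
Hypotheses (Ir : injective r) (xy : x != y) (rxy : fconnect r x y).
Hypothesis r'E : forall z, r' z = r (tperm x y z).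

Lemma split_inj : injective r'.
Proof. by move=> u v; rewrite !r'E => /Ir /perm_inj. Qed.

Lemma split_glued : glued (link e r') (link e r) x y.
Proof.
have Ie := inv_inj eK; have Ir' := split_inj.
have rx : r' y = r x by rewrite r'E tpermR.
have ry : r' x = r y by rewrite r'E tpermL.
have rD z : z != x -> z != y -> r' z = r z.
  by move=> zx zy; rewrite r'E tpermD // eq_sym.
have xyr : connect (link e r) x y.
  by move: rxy; apply: connect_sub => u v /eqP <-; apply: connect_link2.
apply: glued_link => //; try exact: link_sym.
- move=> u v /orP[]/eqP->; first exact: connect_link1.
  have [->|ux] := eqVneq u x.
    by rewrite ry; apply: connect_trans xyr (connect_link2 _ _ _).
  have [->|uy] := eqVneq u y; last by rewrite rD //; apply: connect_link2.
  rewrite rx; apply: connect_trans (connect_link2 _ _ _).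
  by rewrite link_sym.
- move=> u v /orP[]/eqP->; first by rewrite connect_link1.
  have [->|ux] := eqVneq u x.
    by rewrite /near -rx connect_link2 connect0 !orbT.
  have [->|uy] := eqVneq u y.
    by rewrite /near -ry connect_link2 connect0 !orbT.
  by rewrite -rD // connect_link2.
Qed.

(** The number of faces changes by one.  If x and y remain connected, it must
    decrease, since an increase would make the genus negative; then e x and e y lie
    on the face arising from the two which are merged.  If they become
    disconnected, a face falls apart into two. *)
Lemma split_vertex : planar r ->
  planar r' /\ (connect (link e r') x y -> fconnect (r' \o e) (e x) (e y)).
Proof.
have Ie := inv_inj eK; have Ir' := split_inj; rewrite /planar => pl.
have sym : connect_sym (link e r) := link_sym Ie Ir.
have sym' : connect_sym (link e r') := link_sym Ie Ir'.
have g' := genus_fun_ge0 Ir'.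
have comps := card_classes_glued sym' sym split_glued.
have Ire := inj_comp Ir Ie; have Ire' := inj_comp Ir' Ie.
have E1 : perm Ir' = (tperm x y * perm Ir)%g.
  by apply/permP=> z; rewrite permM (permE Ir') (permE Ir) r'E.
have E2 : perm Ire = (tperm (e x) (e y) * perm Ire')%g.
  apply/permP=> z; rewrite permM (permE Ire) (permE Ire') /= r'E.
  have [ez|ex] := eqVneq (e x) z; first by rewrite -ez tpermL !eK tpermR.
  have [ez|ey] := eqVneq (e y) z; first by rewrite -ez tpermR !eK tpermL.
  rewrite (tpermD ex ey) tpermD //.
    by apply: contraNneq ex => xz; rewrite xz eK.
  by apply: contraNneq ey => yz; rewrite yz eK.
have := porbits_mul_tperm (perm Ir) x y; rewrite /= -E1 xy.
have -> : x \in porbit (perm Ir) y.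
  rewrite porbit_sym porbit_fconnect; move: rxy; apply: connect_sub => u v.
  by move/eqP<-; apply: connect1; rewrite /= permE.
have := porbits_mul_tperm (perm Ire') (e x) (e y); rewrite /= -E2.
have -> : e x != e y by rewrite (inj_eq Ie).
rewrite -!classes_perm; have -> : (e x \in porbit (perm Ire') (e y)) =
    fconnect (r' \o e) (e x) (e y).
  rewrite porbit_sym porbit_fconnect; apply: eq_connect => u v.
  by rewrite /= permE.
have imp : fconnect (r' \o e) (e x) (e y) -> connect (link e r') x y.
  move=> exy; rewrite (same_connect sym' (connect_link1 e r' x)).
  rewrite (same_connect_r sym' (connect_link1 e r' y)).
  move: exy; apply: connect_sub => u v /eqP <-.
  by apply: connect_trans (connect_link1 _ _ _) (connect_link2 _ _ _).
move: imp pl g' comps; move: #|classes (link e r)| #|classes (link e r')|.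
move: #|classes (frel r)| #|classes (frel r')| #|classes (frel e)|.
move: #|classes (frel (r \o e))| #|classes (frel (r' \o e))|.
move=> ? ? ? ? ? ? ?; 
case: (connect (link e r') x y); case: (fconnect (r' \o e) (e x) (e y)) => /= imp.
- by move=> *; split=> //; lia.
- by move=> *; exfalso; lia.
- by have := imp isT.
- by move=> *; split=> //; lia.
Qed.

End SplitVertex.
End Surgery.

(** * Checkerboard colourings and surgery on closed curves *)

Section Checkerboard.
Variables (T : finType) (e : T -> T).
Hypotheses (eK : involutive e) (e_neq : forall x, e x != x).
Implicit Types (r : T -> T) (x y : T) (chi : pred T).

Definition checkerboard r chi :=
  (forall u, chi (e u) = ~~ chi u) /\ (forall u, chi (r u) = ~~ chi u).

Lemma link_invol_sym r : injective r -> connect_sym (link e r).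
Proof. by move=> Ir; apply: link_sym => //; apply: inv_inj. Qed.

Section Involution.
Variable r : T -> T.
Hypotheses (rK : involutive r) (r_neq : forall x, r x != x).

Let Ir := inv_inj rK.
Let Ie := inv_inj eK.
Let sym := link_invol_sym Ir.
Let fsym : connect_sym (frel (r \o e)) := fconnect_sym (inj_comp Ir Ie).

(** If a power of r \o e maps u to e u, then e or r fixes the point half-way. *)
Lemma turn_back_free n u : iter n (r \o e) u != e u.
Proof.
have [m] := ubnP n; elim: m n u => // m IH [|[|n]] u; rewrite ltnS => lt_n.
- by rewrite eq_sym.
- exact: r_neq.
have lt_n' : n < m by apply: leq_trans lt_n.
apply: contraNneq (IH n (r (e u)) lt_n') => E.
have -> : iter n (r \o e) (r (e u)) = iter n.+1 (r \o e) u by rewrite iterSr.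
by apply/eqP/(can_inj eK); rewrite eK; apply: (can_inj rK); rewrite -E rK.
Qed.

Lemma connect_oriented u v : connect (link e r) u v ->
  fconnect (r \o e) u v || fconnect (r \o e) u (e v).
Proof.
move=> /connectP[p]; elim/last_ind: p v => [|p w IH] v.
  by move=> _ ->; rewrite connect0.
rewrite rcons_path last_rcons => /andP[/IH/(_ erefl)] + lk ->.
case/orP: lk => /eqP->; first by rewrite eK orbC.
case/orP=> uw; apply/orP; [right|left].
  rewrite (same_connect_r fsym (y := last u p)) //.
  by apply: connect1; rewrite /= eK rK.
by apply: connect_trans uw _; apply: connect1; rewrite /= eK.
Qed.

(** Without double points the faces are the oriented closed curves, and every
    curve has two orientations by [turn_back_free]; colour one of them. *)
Lemma checkerboard_circles : exists chi, checkerboard r chi.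
Proof.
pose chi u := fconnect (r \o e) (fingraph.root (link e r) u) u.
have rt u v : connect (link e r) u v ->
    fingraph.root (link e r) v = fingraph.root (link e r) u.
  by move=> uv; apply/esym/(fingraph.rootP sym).
have flip w u : connect (link e r) w u ->
    fconnect (r \o e) w (e u) = ~~ fconnect (r \o e) w u.
  move/connect_oriented; case: (boolP (fconnect _ w u)) => //= wu _.
  apply/negP=> weu; have : fconnect (r \o e) u (e u).
    by apply: connect_trans weu; rewrite fsym.
  by move/iter_findex/eqP; apply/negP/turn_back_free.
have cu u : connect (link e r) (fingraph.root (link e r) u) u.
  by rewrite sym connect_root.
exists chi; split=> u; rewrite /chi.
  by rewrite (rt _ _ (connect_link1 e r u)) flip.
rewrite (rt _ _ (connect_link2 e r u)) -[r u in LHS]eK flip; last first.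
  apply: connect_trans (cu u) _; apply: connect_trans (connect_link2 e r u) _.
  exact: connect_link1.
congr negb; apply: (same_connect_r fsym).
by apply: connect1; rewrite /= eK rK.
Qed.
End Involution.

(** Merging the vertices of x and y is compatible with a colouring in which x
    and y have the same colour.  This is the case if e x and e y lie on one face, as
    the darts of a face have the same colour.  If x and y are not connected, it
    can be achieved by exchanging the colours in the component of x. *)
Lemma checkerboard_merge r r' x y chi : injective r ->
    (forall z, r' z = r (tperm x y z)) ->
    (connect (link e r') x y -> fconnect (r' \o e) (e x) (e y)) ->
    checkerboard r' chi -> exists chi', checkerboard r chi'.
Proof.
move=> Ir r'E sep [chie chir].
have Ir' : injective r' by move=> u v; rewrite !r'E => /Ir /perm_inj.
have sym := link_invol_sym Ir'.
suff [chi' [chie' chir'] xy] : exists2 chi', checkerboard r' chi' & chi' x = chi' y.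
  exists chi'; split=> // u; rewrite -[u in LHS](tpermK x y) -r'E chir'.
  by case: tpermP => [->|->|]; rewrite ?xy.
have [E|neq] := eqVneq (chi x) (chi y); first by exists chi.
have nxy : ~~ connect (link e r') x y.
  apply: contraNN neq => /sep exy; rewrite -(inj_eq negb_inj) -!chie.
  apply/eqP; move/iter_findex: exy <-; elim: (findex _ _ _) => //= n IH.
  by rewrite chir (chie (iter _ _ _)) negbK.
exists (fun u => chi u (+) connect (link e r') x u); last first.
  by move: neq; rewrite connect0 (negPf nxy); case: (chi x); case: (chi y).
split=> u.
  by rewrite -(same_connect_r sym (connect_link1 e r' u)) chie addNb.
by rewrite -(same_connect_r sym (connect_link2 e r' u)) chir addNb.
Qed.

Lemma even_invol (A : {set T}) r :
  {in A, forall u, [/\ r u \in A, r (r u) = u & r u != u]} -> ~~ odd #|A|.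
Proof.
have [n] := ubnP #|A|; elim: n A => // n IH A; rewrite ltnS => le_n st.
have [->|[u uA]] := set_0Vmem A; first by rewrite cards0.
have [ruA rru nu] := st u uA.
have ru' : r u \in A :\ u by rewrite !inE nu.
have cA : #|A| = (#|A :\ u :\ r u|).+2.
  by rewrite (cardsD1 u) uA (cardsD1 (r u)) ru'.
rewrite cA /= negbK; apply: IH; first by rewrite -ltnS -cA ltnW.
move=> v; rewrite !inE => /and3P[vr vu vA]; have [rvA rrv nv] := st v vA.
split=> //; rewrite rvA andbT; apply/andP; split.
  by apply: contraNneq vu => E; rewrite -rrv E rru.
by apply: contraNneq vr => E; rewrite -rrv E.
Qed.

Section Swap.
Variables (r r' : T -> T) (x y : T).
Hypotheses (rK : involutive r) (r_neq : forall u, r u != u).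
Hypotheses (r'K : involutive r') (r'x : r' x = r y) (r'y : r' y = r x).
Hypothesis r'D : forall u, u \notin [:: x; y; r x; r y] -> r' u = r u.

Let Ir := inv_inj rK.
Let Ir' := inv_inj r'K.
Let sym : connect_sym (link e r) := link_invol_sym Ir.
Let sym' : connect_sym (link e r') := link_invol_sym Ir'.

(** Cut the two arcs, and let A consist of the darts still connected to x.  As
    the edges pair off its elements, A is even.  If the other end r x of the arc were
    not in A, then r would pair off the elements of A other than x. *)
Lemma connect_arc : ~~ connect (link e r) x y -> connect (link e r') x (r x).
Proof.
move=> nxy.
pose Q : rel T := [rel u v | (v == e u) ||
  (u \notin [:: x; y; r x; r y]) && (v == r u)].
have Q1 u : connect Q u (e u) by apply: connect1; rewrite /Q /= eqxx.
have Q2 u : u \notin [:: x; y; r x; r y] -> connect Q u (r u).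
  by move=> uE; apply: connect1; rewrite /Q /= uE eqxx orbT.
have Qr' : subrel (connect Q) (connect (link e r')).
  apply: connect_sub => u v /orP[/eqP->|/andP[/r'D <- /eqP->]].
    exact: connect_link1.
  exact: connect_link2.
have Qr : subrel (connect Q) (connect (link e r)).
  apply: connect_sub => u v /orP[/eqP->|/andP[_ /eqP->]].
    exact: connect_link1.
  exact: connect_link2.
apply: Qr'; apply/negPn/negP => nQ.
pose A := [set u | connect Q x u].
have A_e : {in A, forall u, [/\ e u \in A, e (e u) = u & e u != u]}.
  by move=> u; rewrite !inE => xu; split=> //; apply: connect_trans (Q1 u).
have A_r : {in A :\ x, forall u, [/\ r u \in A :\ x, r (r u) = u & r u != u]}.
  move=> u; rewrite !inE => /andP[ux xu]; split=> //.
  have urx : u != r x by apply: contraNneq nQ => <-.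
  have nyu : ~~ connect (link e r) y u.
    by apply: contra nxy => yu; apply: connect_trans (Qr _ _ xu) _; rewrite sym.
  have uy : u != y by apply: contraNneq nyu => ->.
  have ury : u != r y by apply: contraNneq nyu => ->; apply: connect_link2.
  have ur : u \notin [:: x; y; r x; r y].
    by rewrite !inE !negb_or ux uy urx ury.
  rewrite (connect_trans xu (Q2 _ ur)) andbT.
  by apply: contraNneq urx => <-; rewrite rK.
have := even_invol A_e; have := even_invol A_r.
by rewrite (cardsD1 x A) inE connect0 /= => /negPf->.
Qed.

End Swap.

Lemma swap_merge r r' x y : involutive r -> (forall u, r u != u) ->
  involutive r' -> r' x = r y -> r' y = r x ->
  (forall u, u \notin [:: x; y; r x; r y] -> r' u = r u) ->
  ~~ connect (link e r) x y -> glued (link e r) (link e r') x y.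
Proof.
move=> rK r_neq r'K r'x r'y r'D nxy.
have sym := link_invol_sym (inv_inj rK).
have sym' := link_invol_sym (inv_inj r'K).
have x_rx : connect (link e r') x (r x) by apply: (@connect_arc r r' x y).
have y_ry : connect (link e r') y (r y).
  apply: (@connect_arc r r' y x) => //; last by rewrite sym.
  by move=> u ur; apply: r'D; move: ur; rewrite !inE; do 4!case: eqP.
apply: glued_link => //.
- move=> u v /orP[]/eqP->; first exact: connect_link1.
  have [|/r'D <-] := boolP (u \in [:: x; y; r x; r y]); last exact: connect_link2.
  by rewrite !inE => /or4P[]/eqP->; rewrite ?rK // sym'.
- by apply: connect_trans x_rx _; rewrite -r'y sym'; apply: connect_link2.
move=> u v /orP[]/eqP->; first by rewrite connect_link1.
have [|/r'D ->] := boolP (u \in [:: x; y; r x; r y]); last first.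
  by rewrite connect_link2.
have r'rx : r' (r x) = y by rewrite -r'y r'K.
have r'ry : r' (r y) = x by rewrite -r'x r'K.
rewrite !inE /near => /or4P[]/eqP->; rewrite ?r'x ?r'y ?r'rx ?r'ry;
by rewrite !(connect0, connect_link2) ?orbT.
Qed.

Lemma connect_same_side r chi u v : involutive r -> checkerboard r chi ->
  connect (link e r) u v -> chi u = chi v -> fconnect (r \o e) u v.
Proof.
move=> rK [chie chir] /(connect_oriented rK)/orP[//|].
move/iter_findex; set n := findex _ _ _ => E; have: chi (e v) = chi u.
  rewrite -E; elim: {E}n => //= n IH.
  by rewrite chir chie negbK.
by rewrite chie => <-; case: (chi v).
Qed.

(** On the darts of the colour of x, the faces are the closed curves with one
    of their orientations.  There, the exchange of the two arcs multiplies the face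
    permutation by one transposition, which joins the cycles of x and y if they are
    different and separates them if they are equal. *)
Lemma swap_connect r r' x y chi : involutive r -> (forall u, r u != u) ->
  involutive r' -> r' x = r y -> r' y = r x ->
  (forall u, u \notin [:: x; y; r x; r y] -> r' u = r u) ->
  checkerboard r chi -> checkerboard r' chi -> x != y -> chi x = chi y ->
  connect (link e r') x y = ~~ connect (link e r) x y.
Proof.
move=> rK r_neq r'K r'x r'y r'D chk chk' xy chi_xy.
have [xy_r|nxy] := boolP (connect (link e r) x y); last first.
  by rewrite (swap_merge _ _ r'K r'x r'y r'D nxy) // /near !connect0 !orbT.
apply/negP=> xy_r'.
have Ie := inv_inj eK; have Ir := inv_inj rK; have Ir' := inv_inj r'K.
have [chie chir] := chk; have [_ chir'] := chk'.
have Ire := inj_comp Ir Ie; pose p := perm Ire.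
(* Of the two transpositions by which r' \o e differs from r \o e, this is the one
   that acts on the darts of the colour of x. *)
pose p' := (tperm (e (r x)) (e (r y)) * p)%g.
have px : p (e (r x)) = x by rewrite permE /= eK rK.
have py : p (e (r y)) = y by rewrite permE /= eK rK.
have p'x : p' (e (r x)) = y by rewrite permM tpermL.
have p'y : p' (e (r y)) = x by rewrite permM tpermR.
have p'E u : chi u = chi x -> p' u = r' (e u).
  move=> chi_u; have [->|ux] := eqVneq u (e (r x)).
    by rewrite p'x eK -r'y r'K.
  have [->|uy] := eqVneq u (e (r y)); first by rewrite p'y eK -r'x r'K.
  rewrite permM tpermD 1?eq_sym // permE /= r'D // !inE !negb_or.
  have flip v : chi v = chi x -> e u != v.
    by move=> chi_v; apply: contra_eqN chi_u => /eqP uv; rewrite -chi_v -uv chie;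
       case: (chi u).
  rewrite (flip x) // (flip y) //=; apply/andP; split.
    by apply: contraNneq ux => <-; rewrite eK.
  by apply: contraNneq uy => <-; rewrite eK.
have p'xy : fconnect p' x y.
  have := connect_same_side r'K chk' xy_r' chi_xy.
  move/iter_findex; set n := findex _ _ _ => <-.
  have [-> _] : iter n (r' \o e) x = iter n p' x /\ chi (iter n p' x) = chi x.
    elim: n => //= n [-> chi_n]; rewrite p'E // chir' chie negbK.
    by split.
  exact: fconnect_iter.
have pxy : fconnect p x y.
  have := connect_same_side rK chk xy_r chi_xy.
  by apply: connect_sub => u v /eqP<-; apply: connect1; rewrite /= permE.
have symp (s : {perm T}) : connect_sym (frel s) := fconnect_sym perm_inj.
have xy_e : e (r x) != e (r y) by rewrite (inj_eq Ie) (inj_eq Ir).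
have := porbits_mul_tperm p (e (r x)) (e (r y)).
have := porbits_mul_tperm p' (e (r x)) (e (r y)).
rewrite /= {1}/p' mulgA tperm2 mul1g -/p' xy_e.
have -> : e (r x) \in porbit p (e (r y)).
  rewrite porbit_fconnect; apply: (@connect_trans _ _ y).
    by apply: connect1; rewrite /= py.
  rewrite symp; apply: connect_trans pxy.
  by apply: connect1; rewrite /= px.
have -> : e (r x) \in porbit p' (e (r y)).
  rewrite porbit_fconnect; apply: (@connect_trans _ _ x).
    by apply: connect1; rewrite /= p'y.
  rewrite symp; apply: (@connect_trans _ _ y); last by rewrite symp.
  by apply: connect1; rewrite /= p'x.
by rewrite /=; lia.
Qed.

End Checkerboard.

Section PlanarCircles.
Variables (T : finType) (e r : T -> T).
Hypotheses (eK : involutive e) (e_neq : forall x, e x != x).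
Hypotheses (rK : involutive r) (r_neq : forall x, r x != x).

(** Every closed curve has two faces, one on each side. *)
Lemma planar_circles : planar e r.
Proof.
have Ir := inv_inj rK; have sym := link_invol_sym eK Ir.
have Ire := inj_comp Ir (inv_inj eK).
have := genus_fun_ge0 eK e_neq Ir; rewrite /planar.
have := card_edges eK e_neq; rewrite -(card_edges rK r_neq).
suff: 2 * #|classes (link e r)| <= #|classes (frel (r \o e))|.
  move: #|classes (link e r)| #|classes (frel r)| #|classes (frel e)|.
  by move: #|classes _| => *; lia.
have [chi chk] := checkerboard_circles eK e_neq rK r_neq.
have [chie chir] := chk.
pose side (Cb : {set T} * bool) := [set u in Cb.1 | chi u == Cb.2].
pose S := [set Cb | (Cb.1 \in classes (link e r)) && true] : {set {set T} * bool}.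
have cardS : #|S| = 2 * #|classes (link e r)|.
  rewrite mulnC -card_bool -cardsT -cardsX; apply: eq_card => -[C b].
  by rewrite !inE.
have ex_side C b : C \in classes (link e r) ->
    exists2 u, C = [set v | connect (link e r) u v] & chi u = b.
  case/imsetP=> u _ ->; have [E|E] := eqVneq (chi u) b; first by exists u.
  exists (e u); last by rewrite chie; case: b E; case: (chi u).
  by apply/eqP; rewrite eq_class // connect_link1.
have sideE u : side ([set v | connect (link e r) u v], chi u) =
    [set v | fconnect (r \o e) u v].
  apply/setP=> v; rewrite !inE; apply/andP/idP => [[uv /eqP E]|uv].
    exact: (connect_same_side eK rK chk).
  have sub : subrel (frel (r \o e)) (connect (link e r)).
    move=> a b /eqP <-.
    exact: connect_trans (connect_link1 _ _ _) (connect_link2 _ _ _).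
  split; first by move: uv; apply: connect_sub.
  apply/eqP; move/iter_findex: uv <-; elim: (findex _ _ _) => //= n <-.
  by rewrite chir chie negbK.
rewrite -cardS -(card_in_imset (f := side)).
  apply/subset_leq_card/subsetP=> A /imsetP[[C b]]; rewrite inE andbT => CS ->.
  by have [u Eu <-] := ex_side C b CS; rewrite /= Eu sideE; apply: imset_f.
move=> [C b] [C' b']; rewrite !inE !andbT => CS CS'.
have [u Eu <-] := ex_side C b CS; have [u' Eu' <-] := ex_side C' b' CS'.
rewrite /= Eu Eu' !sideE => /setP/(_ u'); rewrite !inE connect0 => uu'.
have := sideE u; move/setP/(_ u'); rewrite !inE uu' => /andP[cu /eqP->].
by congr (_, _); apply/eqP; rewrite eq_class.
Qed.
End PlanarCircles.

Lemma planarE (T : finType) (e r : T -> T) : injective e -> injective r ->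
  planar e r <-> fcard r T + fcard (r \o e) T = fcard e T + 2 * n_comp (link e r) T.
Proof.
move=> Ie Ir; have Ire := inj_comp Ir Ie.
rewrite /planar !card_classes //; try exact: link_sym; exact: fconnect_sym.
Qed.

(** * Partial resolutions of a diagram *)

Section Diagrams.
Variable D : diagram.
Implicit Types (x : dart D) (c : crossing D) (s T : {set crossing D}).

Let dP := diagramP D.
Lemma edgeK : involutive (@edge D). Proof. exact: diagram_edgeK dP. Qed.
Lemma edge_neq x : edge x != x. Proof. exact: diagram_edge_neq dP x. Qed.
Lemma rot4 x : rot (rot (rot (rot x))) = x. Proof. exact: diagram_rot4 dP x. Qed.
Lemma rot_neq x : rot x != x. Proof. exact: diagram_rot_neq dP x. Qed.
Lemma rot_inj : injective (@rot D).
Proof. exact: (@can_inj _ _ _ (fun x => rot (rot (rot x))) rot4). Qed.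
Lemma over_rot x : at_crossing x -> over (rot x) = ~~ over x.
Proof. exact: diagram_over dP x. Qed.

End Diagrams.

Section PartialResolutions.
Variable D : diagram.
Implicit Types (x : dart D) (c : crossing D) (s T : {set crossing D}).

Lemma fconnect_rot x y :
  fconnect rot x y = (y \in [:: x; rot x; rot (rot x); rot (rot (rot x))]).
Proof.
rewrite !inE; apply/idP/or4P => [|[]/eqP->]; last first.
- exact: (fconnect_iter rot 3 x).
- exact: (fconnect_iter rot 2 x).
- exact: fconnect1.
- exact: connect0.
move/iter_findex <-; elim: (findex _ _ _) => [|n]; first by constructor 1.
case=> /eqP /= ->; first [by constructor 2 | by constructor 3 |
  by constructor 4 | by constructor 1; rewrite rot4].
Qed.

Lemma at_crossing_rot x : at_crossing (rot x) = at_crossing x.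
Proof. by rewrite /at_crossing (inj_eq (@rot_inj D)). Qed.

Lemma incident_rot c x : incident c (rot x) = incident c x.
Proof.
rewrite /incident; apply/esym/same_connect_r; last exact: fconnect1.
exact/fconnect_sym/rot_inj.
Qed.

Lemma crossing_val c : at_crossing (val c).
Proof. by case/andP: (valP c). Qed.

Lemma incident_crossing c x : incident c x -> at_crossing x.
Proof.
rewrite /incident fconnect_rot !inE => /or4P[]/eqP->;
by rewrite ?at_crossing_rot crossing_val.
Qed.

Lemma crossing_at x : at_crossing x -> exists c, incident c x.
Proof.
move=> cr; have sym : connect_sym (frel (@rot D)) := fconnect_sym (@rot_inj D).
have P : at_crossing (froot rot x) && (froot rot (froot rot x) == froot rot x).
  rewrite (root_root sym) eqxx andbT.
  have := connect_root (frel rot) x; rewrite fconnect_rot !inE.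
  by case/or4P=> /eqP->; rewrite ?at_crossing_rot.
exists (exist (fun y => at_crossing y && (froot rot y == y)) _ P).
by rewrite /incident /= sym connect_root.
Qed.

Lemma incident_inj c c' x : incident c x -> incident c' x -> c = c'.
Proof.
have sym : connect_sym (frel (@rot D)) := fconnect_sym (@rot_inj D).
rewrite /incident => cx c'x; apply: val_inj.
have /andP[_ /eqP <-] := valP c; have /andP[_ /eqP <-] := valP c'.
apply/(fingraph.rootP sym); apply: connect_trans cx _.
by rewrite sym.
Qed.

Definition touches T x := [exists c in T, incident c x].

Lemma touchesE T c x : incident c x -> touches T x = (c \in T).
Proof.
move=> cx; apply/existsP/idP => [[c' /andP[c'T c'x]]|cT]; last by exists c; rewrite cT.
by rewrite (incident_inj cx c'x).
Qed.

Lemma touches_at T x : touches T x -> at_crossing x.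
Proof. by case/existsP=> c /andP[_ /incident_crossing]. Qed.

Lemma touches_rot T x : touches T (rot x) = touches T x.
Proof. by apply: eq_existsb => c; rewrite incident_rot. Qed.

Lemma touchesU1 T c x : ~~ incident c x -> touches (c |: T) x = touches T x.
Proof.
move=> cx; apply: eq_existsb => c'; rewrite !inE.
by have [->|//] := eqVneq c' c; rewrite (negPf cx) !andbF.
Qed.

Lemma touchesT x : touches setT x = at_crossing x.
Proof.
apply/idP/idP => [/touches_at//|/crossing_at[c cx]].
by rewrite (touchesE _ cx) inE.
Qed.

Definition partial_rot T s x :=
  if touches T x then partner (touches s x) x else rot x.

Definition partial T s : prediagram :=
  @Prediagram (dart D) edge (partial_rot T s) over.

Lemma partner_rot b x : partner b x = rot x \/ partner b x = rot (rot (rot x)).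
Proof. by rewrite /partner; case: ifP; [right | left]. Qed.

Lemma touches_partial T s T' x : touches T' (partial_rot T s x) = touches T' x.
Proof.
rewrite /partial_rot; case: ifP => _; last exact: touches_rot.
by case: (partner_rot (touches s x) x) => ->; rewrite !touches_rot.
Qed.

Lemma partnerK b x : at_crossing x -> partner b (partner b x) = x.
Proof.
move=> cx; have ov3 : over (rot (rot (rot x))) = ~~ over x.
  by rewrite !over_rot ?at_crossing_rot // !negbK.
rewrite /partner; case ob: (over x (+) b); rewrite ?ov3 ?over_rot // addNb ob /=;
exact: rot4.
Qed.

Lemma partialK T s x : touches T x -> partial_rot T s (partial_rot T s x) = x.
Proof.
move=> Tx; rewrite {1}/partial_rot !touches_partial Tx /partial_rot Tx.
by rewrite partnerK // (touches_at Tx).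
Qed.

Lemma partial_rot_neq T s x : partial_rot T s x != x.
Proof.
rewrite /partial_rot; case: ifP => _; last exact: rot_neq.
case: (partner_rot (touches s x) x) => ->; first exact: rot_neq.
by apply: contraNneq (rot_neq x) => E; rewrite -{1}E rot4.
Qed.

Lemma partial_rot4 T s x :
  let r := partial_rot T s in r (r (r (r x))) = x.
Proof.
move=> r; have [Tx|Tx] := boolP (touches T x); first by rewrite /r !partialK.
have rE y : touches T y = false -> r y = rot y by rewrite /r /partial_rot => ->.
by rewrite !rE ?touches_rot ?(negPf Tx) // rot4.
Qed.

Lemma partial_rot_inj T s : injective (partial_rot T s).
Proof.
pose r := partial_rot T s.
exact: (@can_inj _ _ _ (fun x => r (r (r x))) (partial_rot4 T s)).
Qed.

Lemma partial_over T s (x : dart (partial T s)) :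
  at_crossing x -> over (rot x) = ~~ over x.
Proof.
rewrite /at_crossing /=; have [Tx|Tx] := boolP (touches T x).
  by rewrite partialK ?eqxx.
rewrite /partial_rot (negPf Tx) touches_rot (negPf Tx).
exact: over_rot.
Qed.

(** The resolution of c multiplies the 4-cycle of its darts by the
    transposition of the two ends of one of its strands: of the overstrand or of the
    understrand, depending on the resolution. *)
Lemma partial_rotU1 T s c : c \notin T -> exists x, [/\ incident c x,
  x != rot (rot x)
  & forall z, partial_rot (c |: T) s z = partial_rot T s (tperm x (rot (rot x)) z)].
Proof.
move=> cT; pose x := if over (val c) (+) (c \in s) then val c else rot (val c).
have cx : incident c x.
  by rewrite /x; case: ifP => _; rewrite ?incident_rot /incident connect0.
have crx := incident_crossing cx.
have ovx : over x (+) (c \in s).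
  by rewrite /x; case: ifP => // ov; rewrite over_rot ?crossing_val // addNb ov.
exists x; split=> //; first by rewrite eq_sym.
have notT z : incident c z -> touches T z = false.
  by move=> cz; rewrite (touchesE _ cz) (negPf cT).
have cT' z : incident c z -> touches (c |: T) z.
  by move=> cz; rewrite (touchesE _ cz) setU11.
have ov2 : over (rot (rot x)) = over x.
  by rewrite !over_rot ?at_crossing_rot // negbK.
move=> z; case: tpermP => [->|->|/eqP zx /eqP zy].
- rewrite /partial_rot cT' // notT ?incident_rot // (touchesE _ cx).
  by rewrite /partner ovx.
- rewrite /partial_rot cT' ?incident_rot // notT // (touchesE _ (c := c)) ?incident_rot //.
  by rewrite /partner ov2 ovx rot4.
have [cz|cz] := boolP (incident c z); last by rewrite /partial_rot touchesU1.
rewrite /partial_rot cT' // notT // (touchesE _ cz) /partner.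
have: fconnect rot x z.
  apply: connect_trans cz; rewrite fconnect_sym //; exact: rot_inj.
rewrite fconnect_rot !inE (negPf zx) (negPf zy) /= => /orP[]/eqP->;
by rewrite !over_rot ?at_crossing_rot // ?negbK addNb ovx.
Qed.

End PartialResolutions.

Section States.
Variable D : diagram.
Implicit Types (x : dart D) (c : crossing D) (s T : {set crossing D}).

Lemma partial_rot0 s : partial_rot set0 s =1 @rot D.
Proof.
move=> x; rewrite /partial_rot; case: ifP => // /existsP[c].
by rewrite inE.
Qed.

Lemma rot_planar : planar (@edge D) (@rot D).
Proof.
by apply/planarE; [exact/inv_inj/edgeK | exact: rot_inj | exact: diagram_planar (diagramP D)].
Qed.

Lemma eq_planar (K : finType) (e r r' : K -> K) : r =1 r' -> planar e r -> planar e r'.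
Proof.
move=> rr; rewrite /planar.
have -> : classes (frel r') = classes (frel r).
  by apply/eq_classes/eq_connect => u v; rewrite /= rr.
have -> : classes (frel (r' \o e)) = classes (frel (r \o e)).
  by apply/eq_classes/eq_connect => u v; rewrite /= rr.
have -> // : classes (link e r') = classes (link e r).
by apply/eq_classes/eq_connect/eq_link.
Qed.

Lemma partial_split T s c x : c \notin T -> incident c x ->
  fconnect (partial_rot T s) x (rot (rot x)).
Proof.
move=> cT cx; have E y : incident c y -> partial_rot T s y = rot y.
  by move=> cy; rewrite /partial_rot (touchesE _ cy) (negPf cT).
rewrite -E ?incident_rot // -E //.
exact: (fconnect_iter (partial_rot T s) 2 x).
Qed.

(** Resolve the double points one at a time. *)
Lemma partial_planar T s : planar (@edge D) (partial_rot T s).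
Proof.
have [n] := ubnP #|T|; elim: n T => // n IH T; rewrite ltnS => le_n.
have [->|[c cT]] := set_0Vmem T.
  by apply: (eq_planar _ rot_planar) => x; rewrite partial_rot0.
rewrite -(setD1K cT).
have c' : c \notin T :\ c by rewrite !inE eqxx.
have [x [cx xy E]] := partial_rotU1 s c'.
have [] // := split_vertex (@edgeK D) (@edge_neq D)
  (@partial_rot_inj D (T :\ c) s) xy (partial_split s c' cx) E.
by apply: IH; apply: leq_trans le_n; rewrite [X in _ < X](cardsD1 c) cT.
Qed.

Lemma partial_is_diagram T s : is_diagram (partial T s).
Proof.
split; [exact: edgeK | exact: edge_neq | exact: partial_rot4
  | exact: partial_rot_neq | exact: partial_over |].
apply/(@planarE (dart D) edge (partial_rot T s)); last exact: partial_planar.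
  exact/inv_inj/edgeK.
exact: partial_rot_inj.
Qed.

Definition partial_diagram T s := Diagram (partial_is_diagram T s).

(** The colouring is built by undoing the resolution of the double points one at
    a time, starting from a family of closed curves. *)
Lemma diagram_checkerboard : exists chi, checkerboard (@edge D) (@rot D) chi.
Proof.
suff chk T : exists chi, checkerboard (@edge D) (partial_rot T set0) chi.
  have [chi [chie chir]] := chk set0.
  by exists chi; split=> // u; rewrite -(partial_rot0 set0).
have [n] := ubnP #|~: T|; elim: n T => // n IH T; rewrite ltnS => le_n.
have [T0|[c]] := set_0Vmem (~: T).
  apply: (checkerboard_circles (@edgeK D) (@edge_neq D)) => x; last exact: partial_rot_neq.
  have [Tx|Tx] := boolP (touches T x); first exact: partialK.
  have [cr|] := boolP (at_crossing x).
    by move: Tx; rewrite -[T]setCK T0 setC0 touchesT cr.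
  rewrite {1}/partial_rot touches_partial (negPf Tx) /partial_rot (negPf Tx).
  by rewrite /at_crossing negbK => /eqP.
rewrite inE => cT; have [x [cx xy E]] := partial_rotU1 set0 cT.
have [] := split_vertex (@edgeK D) (@edge_neq D)
  (@partial_rot_inj D T set0) xy (partial_split set0 cT cx) E.
  exact: partial_planar.
move=> _ sep; have [|chi chk] := IH (c |: T).
  apply: leq_trans le_n; rewrite [X in _ < X](cardsD1 c) inE cT.
  by rewrite setCU setDE setIC.
exact: (checkerboard_merge (@edgeK D) (@partial_rot_inj D T set0) E sep chk).
Qed.

Lemma resolveE s x : resolve s x = partial_rot setT s x.
Proof. by rewrite /partial_rot touchesT. Qed.

(** Resolving only changes the neighbour of a dart at its double point from
    [rot x] to [rot^-1 x], which has the same colour. *)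
Lemma checkerboard_resolve s chi : checkerboard (@edge D) (@rot D) chi ->
  checkerboard (@edge D) (resolve s) chi.
Proof.
case=> chie chir; split=> // u; rewrite /resolve; case: ifP => _ //.
by case: (partner_rot (touches s u) u) => ->; rewrite !chir ?negbK.
Qed.

Lemma partial_resolution T s c : c \notin T -> c \notin s ->
  exists c' : crossing (partial_diagram T s), forall b,
    isomorphic (partial (c |: T) (if b then c |: s else s)) (resolution c' b).
Proof.
move=> cT cs; set P := partial_diagram T s.
have E y : incident c y -> @rot P y = rot y.
  by move=> cy; rewrite /= /partial_rot (touchesE _ cy) (negPf cT).
have vc : incident c (val c) by apply: connect0.
have crP : @at_crossing P (val c).
  by rewrite /at_crossing !E ?incident_rot //; exact: crossing_val.
have [c' c'c] := @crossing_at P _ crP; exists c'.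
have sym : connect_sym (frel (@rot P)) := fconnect_sym (@rot_inj P).
have c'E x : incident c' x = incident c x.
  rewrite /incident (same_connect sym c'c) (@fconnect_rot P) fconnect_rot.
  by rewrite !E ?incident_rot.
move=> b; exists id; split=> //; first by exists id.
suff rotE (x : dart D) : partial_rot (c |: T) (if b then c |: s else s) x =
  (if incident c' x then partner b (x : dart P) else @rot P x) by [].
have [cx|cx] := boolP (incident c x); last first.
  by rewrite c'E (negPf cx) /partial_rot touchesU1 //; case: (b); rewrite ?touchesU1.
rewrite c'E cx [RHS]/partner !E ?incident_rot // /partial_rot (touchesE _ cx) setU11.
by rewrite (touchesE _ cx) /partner; case: (b); rewrite ?setU11 ?(negPf cs).
Qed.

End States.

Local Open Scope ring_scope.

(** * Evaluation of the Kauffman bracket *)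

Section Subdiagram.
Variables (D : prediagram) (A : pred (dart D)).
Hypothesis A_edge : forall x : dart D, A (edge x) = A x.
Hypothesis A_rot : forall x : dart D, A (rot x) = A x.

Definition subdiagram : prediagram :=
  @Prediagram {x : dart D | A x} (fun u => insubd u (edge (val u)))
    (fun u => insubd u (rot (val u))) (fun u => over (val u)).

Lemma val_edge (u : dart subdiagram) : val (edge u) = edge (val u : dart D).
Proof. by rewrite val_insubd A_edge (valP u). Qed.

Lemma val_rot (u : dart subdiagram) : val (rot u) = rot (val u : dart D).
Proof. by rewrite val_insubd A_rot (valP u). Qed.

Lemma n_comp_subdiagram : injective (@edge D) -> injective (@rot D) ->
  n_comp (@glink D) A = n_comp (@glink subdiagram) {: dart subdiagram}.
Proof.
move=> Ie Ir; have sym : connect_sym (@glink D) := link_sym Ie Ir.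
have sym' : connect_sym (@glink subdiagram).
  apply: link_sym => u v.
    by move/(congr1 val); rewrite !val_edge => /Ie /val_inj.
  by move/(congr1 val); rewrite !val_rot => /Ir /val_inj.
have clA : closed (@glink D) A.
  by move=> x y /orP[]/eqP->; rewrite !unfold_in ?A_edge ?A_rot.
have adj : rel_adjunction (val : dart subdiagram -> dart D) (@glink D)
    (@glink subdiagram) A.
  apply: strict_adjunction => //; first exact: val_inj.
    by apply/fintype.subsetP => x Ax; apply/codomP; exists (exist A x Ax).
  by move=> u v _; rewrite /glink /= -!val_eqE /= val_edge val_rot.
rewrite (adjunction_n_comp _ sym sym' clA adj).
by apply: eq_n_comp_r => u; rewrite !inE; exact: (valP u).
Qed.

End Subdiagram.

Section CrossingFree.
Variable D : prediagram.
Hypotheses (eK : involutive (@edge D)) (e_neq : forall x : dart D, edge x != x).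
Hypotheses (rK : involutive (@rot D)) (r_neq : forall x : dart D, rot x != x).

Lemma no_crossing (x : dart D) : at_crossing x = false.
Proof. by rewrite /at_crossing rK eqxx. Qed.

Lemma crossing_free_is_diagram : is_diagram D.
Proof.
split=> // [x|x|]; rewrite ?rK ?no_crossing //.
apply/(planarE (inv_inj eK) (inv_inj rK)).
exact: planar_circles.
Qed.

End CrossingFree.

Definition loop_pre : prediagram := @Prediagram bool negb negb pred0.

Lemma loop_is_diagram : is_diagram loop_pre.
Proof. by apply: crossing_free_is_diagram; by case. Qed.

Definition loop_diagram := Diagram loop_is_diagram.

Definition empty_pre : prediagram := @Prediagram void id id pred0.

Lemma empty_is_diagram : is_diagram empty_pre.
Proof. by apply: crossing_free_is_diagram; by case. Qed.

Definition empty_diagram := Diagram empty_is_diagram.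

Lemma mul_add_inv (F : fieldType) (a : F) : a != 0 -> a * (a + a^-1) = a ^+ 2 + 1.
Proof. by move=> a0; rewrite mulrDr divff. Qed.

Section Bracket.
Variables (br : diagram -> qfrac) (brP : is_kauffman_bracket br).

Lemma q_neq0 : q != 0.
Proof. by rewrite /q tofrac_eq0 polyX_eq0. Qed.

Definition loop_value : qfrac := q + q^-1.

Lemma loop_value_neq0 : loop_value != 0.
Proof.
have : q * loop_value != 0.
  rewrite /loop_value (mul_add_inv q_neq0).
  rewrite /q -tofracXn -tofrac1 -tofracD tofrac_eq0.
  by rewrite -size_poly_eq0 -polyC1 size_XnaddC.
by apply: contraNneq => ->; rewrite mulr0.
Qed.

Lemma is_loop_loop : is_loop loop_diagram.
Proof.
split=> [|[]] //; rewrite -(n_comp_connect (e := @glink loop_pre) _ true).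
  apply: eq_n_comp_r => b; transitivity true => //; apply/esym.
  by case: b; [apply: connect0 | apply: (connect_link1 negb negb true)].
exact: (link_sym (inv_inj negbK) (inv_inj negbK)).
Qed.

Lemma isomorphic_disjoint_empty (D : prediagram) (E : prediagram) :
  #|dart E| = 0%N -> forall F, isomorphic D F -> isomorphic D (disjoint_union F E).
Proof.
move=> E0 F [f [f_bij fe fr fo]].
exists (fun x => inl (f x)); split=> [||| x cr] /=; last exact: fo.
- case: f_bij => g fK gK.
  exists (fun u => match u with
    | inl y => g y | inr z => match fintype0 z E0 with end end).
    by move=> x; rewrite fK.
  by case=> [y|z]; [rewrite gK | case: (fintype0 z E0)].
- by move=> x; rewrite fe.
- by move=> x; rewrite fr.
Qed.

Lemma isomorphic_refl (D : prediagram) : isomorphic D D.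
Proof. by exists id; split=> //; exists id. Qed.

(** A loop is the disjoint union of itself and of the empty diagram, and its
    bracket is not zero. *)
Lemma bracket_empty : br empty_diagram = 1.
Proof.
have /(bracket_disjoint_union brP) : isomorphic loop_diagram
    (disjoint_union loop_diagram empty_diagram).
  by apply: isomorphic_disjoint_empty (isomorphic_refl _); rewrite card_void.
rewrite (bracket_loop brP is_loop_loop) => E.
by apply: (mulfI loop_value_neq0); rewrite mulr1 -E.
Qed.

(** Isomorphism invariance is part of the disjoint union axiom: take the empty
    diagram as the second component. *)
Lemma bracket_iso (D E : diagram) : isomorphic D E -> br D = br E.
Proof.
move=> iso; rewrite -[RHS]mulr1 -bracket_empty; apply: (bracket_disjoint_union brP).
by apply: isomorphic_disjoint_empty iso; rewrite card_void.
Qed.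

(** Split off one component at a time.  The components are planar because every
    family of closed curves is, by [planar_circles]. *)
Lemma bracket_crossing_free (D : diagram) : (forall x : dart D, ~~ at_crossing x) ->
  br D = loop_value ^+ n_comp (@glink D) {: dart D}.
Proof.
have [n] := ubnP #|dart D|; elim: n D => // n IH D; rewrite ltnS => le_n no_cr.
have rK : involutive (@rot D) by move=> x; have := no_cr x; rewrite negbK => /eqP.
have Ie := inv_inj (@edgeK D); have Ir := @rot_inj D.
have sym : connect_sym (@glink D) := link_sym Ie Ir.
have [x0 _|D0] := pickP (dart D); last first.
  have cD : #|dart D| = 0%N by apply: eq_card0 => x; have := D0 x.
  rewrite (_ : n_comp _ _ = 0%N); last by apply: eq_card0 => x; have := D0 x.
  rewrite expr0 -bracket_empty; apply: bracket_iso.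
  exists (fun x => match fintype0 x cD with end).
  split=> [|x|x|x]; [|by case: (fintype0 x cD)..].
  by exists (fun v : void => match v with end) => [x|[]]; case: (fintype0 x cD).
pose A (x : dart D) := connect (@glink D) x0 x.
have A_edge x : A (edge x) = A x.
  exact/esym/(same_connect_r sym)/(connect_link1 (@edge D) rot).
have A_rot x : A (rot x) = A x.
  exact/esym/(same_connect_r sym)/(connect_link2 (@edge D) rot).
pose B := predC A.
have B_edge x : B (edge x) = B x by rewrite /B /= A_edge.
have B_rot x : B (rot x) = B x by rewrite /B /= A_rot.
have sub_diag (C : pred (dart D)) :
    (forall x, C (edge x) = C x) -> (forall x, C (rot x) = C x) ->
    is_diagram (subdiagram C).
  move=> C_edge C_rot; apply: crossing_free_is_diagram => u.
  - by apply: val_inj; rewrite !val_edge // edgeK.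
  - by rewrite -val_eqE val_edge // edge_neq.
  - by apply: val_inj; rewrite !val_rot // rK.
  - by rewrite -val_eqE val_rot // rot_neq.
have sub_no_cr (C : pred (dart D)) : (forall x, C (rot x) = C x) -> 
    forall u : dart (subdiagram C), ~~ at_crossing u.
  by move=> C_rot u; rewrite negbK -val_eqE !val_rot // rK.
pose DA := Diagram (sub_diag A A_edge A_rot).
pose DB := Diagram (sub_diag B B_edge B_rot).
have -> : br D = br DA * br DB.
  apply: (bracket_disjoint_union brP).
  pose g (u : dart (disjoint_union DA DB)) : dart D :=
    match u with inl y => val y | inr y => val y end.
  have gI : injective g.
    move=> [u|u] [v|v] //= uv; try by congr (_ _); apply: val_inj.
      have Au : A (val u) := valP u; have : ~~ A (val v) := valP v.
      by move: Au; rewrite (uv : val u = val v) => ->.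
    have Av : A (val v) := valP v; have : ~~ A (val u) := valP u.
    by move: Av; rewrite -(uv : val u = val v) => ->.
  have [|f gK fK] := inj_card_bij gI.
    by rewrite card_sum !card_sig (cardC A).
  have ge u : g (edge u) = edge (g u) by case: u => u; rewrite /= val_edge.
  have gr u : g (rot u) = rot (g u) by case: u => u; rewrite /= val_rot.
  exists f; split; first by exists g.
  - by move=> x; apply: gI; rewrite ge !fK.
  - by move=> x; apply: gI; rewrite gr !fK.
  - by move=> x; rewrite (negPf (no_cr x)).
have loopA : is_loop DA.
  by split; [rewrite -n_comp_subdiagram // n_comp_connect | apply: sub_no_cr].
have ltB : (#|dart DB| < n)%N.
  apply: leq_trans le_n; rewrite card_sig -[X in (_ < X)%N](cardC A).
  rewrite -[X in (X < _)%N]add0n ltn_add2r lt0n.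
  by apply/pred0Pn; exists x0; apply: connect0.
rewrite (bracket_loop brP loopA) (IH DB ltB (sub_no_cr B B_rot)) -exprS.
congr (_ ^+ _); rewrite [RHS](n_compC A) (n_comp_connect sym x0) add1n.
by rewrite -(n_comp_subdiagram B_edge B_rot).
Qed.

End Bracket.

Section StateSum.
Variables (br : diagram -> qfrac) (brP : is_kauffman_bracket br) (D : diagram).
Implicit Types (c : crossing D) (s T : {set crossing D}).

Definition partial_sum T :=
  \sum_(s : {set crossing D} | s \subset T) (- q) ^+ #|s| * br (partial_diagram T s).

Lemma partial_skein T s c : c \notin T -> c \notin s ->
  br (partial_diagram T s) = br (partial_diagram (c |: T) s)
    - q * br (partial_diagram (c |: T) (c |: s)).
Proof.
move=> cT cs; have [c' iso] := partial_resolution cT cs.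
exact: (@bracket_skein br brP (partial_diagram T s) (partial_diagram (c |: T) s)
  (partial_diagram (c |: T) (c |: s)) c' (iso false) (iso true)).
Qed.

(** The skein relation at c pairs the states s and c |: s. *)
Lemma partial_sumU1 T c : c \notin T -> partial_sum (c |: T) = partial_sum T.
Proof.
move=> cT; rewrite /partial_sum (bigID (fun s => c \in s)) /=.
rewrite (reindex_onto (fun s => c |: s) (fun s => s :\ c)) /=; last first.
  by move=> s /andP[_ /setD1K].
have E (s : {set crossing D}) :
    (c |: s \subset c |: T) && (c \in c |: s) && ((c |: s) :\ c == s) =
    (s \subset T).
  rewrite setU11 andbT; apply/andP/idP => [[sub /eqP sE]|sub].
    rewrite -sE; apply/fintype.subsetP => z; rewrite !inE => /andP[zc].
    rewrite (negPf zc) /= => zs; have := fintype.subsetP sub z.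
    by rewrite !inE zs orbT (negPf zc) => /(_ isT).
  split; first exact: finset.setUS.
  by rewrite setU1K // (contra (fintype.subsetP sub c)).
have E' (s : {set crossing D}) : (s \subset c |: T) && (c \notin s) = (s \subset T).
  apply/andP/idP => [[sub cs]|sub]; last first.
    split; last exact: contra (fintype.subsetP sub c) cT.
    exact: fintype.subset_trans sub (finset.subsetUr _ _).
  apply/fintype.subsetP => z zs; have := fintype.subsetP sub z zs.
  by rewrite !inE => /orP[/eqP zc|//]; rewrite zc (negPf cs) in zs.
rewrite (eq_bigl _ _ E) (eq_bigl _ _ E') addrC -big_split /=.
apply: eq_bigr => s sT; have cs : c \notin s by apply: contra (fintype.subsetP sT c) cT.
rewrite (partial_skein cT cs) mulrBr cardsU1 cs exprS mulrA.
by rewrite mulNr mulNr [q * _]mulrC.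
Qed.

Lemma partial_sumT T : partial_sum T = br D.
Proof.
have [n] := ubnP #|T|; elim: n T => // n IH T; rewrite ltnS => le_n.
have [->|[c cT]] := set_0Vmem T.
  rewrite /partial_sum (big_pred1 set0) => [|s]; last by rewrite finset.subset0.
  rewrite cards0 expr0 mul1r; apply: (bracket_iso brP).
  exists id; split=> //; first by exists id.
  by move=> x; apply: (@partial_rot0 D).
rewrite -(setD1K cT) partial_sumU1 ?inE ?eqxx //.
by apply: IH; apply: leq_trans le_n; rewrite [X in (_ < X)%N](cardsD1 c) cT.
Qed.

Lemma bracket_state_sum :
  br D = \sum_(s : {set crossing D}) (- q) ^+ #|s| * loop_value ^+ #|circles s|.
Proof.
rewrite -(partial_sumT setT) /partial_sum.
rewrite (eq_bigl xpredT); last by move=> s; rewrite finset.subsetT.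
apply: eq_bigr => s _; congr (_ * _).
rewrite (bracket_crossing_free brP) => [|x]; last first.
  rewrite negbK; apply/eqP; have [cr|cr] := boolP (@at_crossing D x).
    by apply: (@partialK D setT s x); rewrite touchesT.
  rewrite /= /partial_rot !touchesT (negPf cr) at_crossing_rot (negPf cr).
  by apply/eqP; move: cr; rewrite negbK.
rewrite -card_classes; last first.
  by apply: link_sym; [exact/inv_inj/edgeK | exact: (@partial_rot_inj D setT s)].
suff -> : classes (@glink (partial_diagram setT s)) = circles s by [].
apply: (@eq_classes (dart D)); apply: eq_connect => x y.
by rewrite /glink /strand /= resolveE.
Qed.

End StateSum.

(** * The edge maps of the cube *)

Section CircleSurgery.
Variable D : diagram.
Implicit Types (x y z u : dart D) (a b : crossing D) (s t : {set crossing D}).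

Local Notation cn s := (connect (@strand D s)).
Local Notation opp a := (rot (rot (val a : dart D))).

Lemma resolveK s : involutive (resolve s : dart D -> dart D).
Proof.
move=> x; rewrite !resolveE; have [cr|cr] := boolP (at_crossing x).
  by apply: partialK; rewrite touchesT.
rewrite {1}/partial_rot touches_partial /partial_rot touchesT (negPf cr).
by apply/eqP; move: cr; rewrite negbK.
Qed.

Lemma resolve_neq s x : resolve s x != x.
Proof. by rewrite resolveE partial_rot_neq. Qed.

Lemma strand_sym s : connect_sym (@strand D s).
Proof. exact: (link_invol_sym (@edgeK D) (inv_inj (resolveK s))). Qed.

Lemma incident_val a : incident a (val a). Proof. exact: connect0. Qed.

Lemma over_opp x : at_crossing x -> over (rot (rot x)) = over x.
Proof. by move=> cx; rewrite !over_rot ?at_crossing_rot // negbK. Qed.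

Lemma resolve_incident s a x : incident a x -> resolve s x = partner (a \in s) x.
Proof.
move=> ax; rewrite /resolve (incident_crossing ax) -/(touches s x).
by rewrite (touchesE _ ax).
Qed.

(** The two resolutions differ by the exchange of the other ends of the two arcs
    which leave opposite darts of the double point. *)
Lemma resolve_opp a s : a \notin s ->
  resolve (a |: s) (val a) = resolve s (opp a) /\
  resolve (a |: s) (opp a) = resolve s (val a).
Proof.
move=> as_; have va := incident_val a; have cr := crossing_val a.
rewrite !(resolve_incident _ (a := a)) ?incident_rot // setU11 (negPf as_).
by rewrite /partner over_opp //; case: (over _); rewrite /= ?rot4.
Qed.

Lemma resolve_far a s z : a \notin s ->
    z \notin [:: val a; opp a; resolve s (val a); resolve s (opp a)] ->
  resolve (a |: s) z = resolve s z.
Proof.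
move=> as_ zE; have az : ~~ incident a z.
  apply: contra zE; rewrite /incident fconnect_rot.
  rewrite !(resolve_incident _ (a := a)) ?incident_rot ?incident_val //.
  rewrite (negPf as_) /partner over_opp ?crossing_val // !inE.
  by case: (over _); rewrite /= ?rot4; do 4!case: eqP.
by rewrite !resolveE /partial_rot !touchesT -!/(touches _ _) touchesU1.
Qed.

Lemma val_opp a : (val a : dart D) != opp a.
Proof. by rewrite eq_sym; exact: crossing_val. Qed.

Lemma merge_glued a s : a \notin s -> ~~ cn s (val a) (opp a) ->
  glued (strand s) (strand (a |: s)) (val a) (opp a).
Proof.
move=> as_; have [E1 E2] := resolve_opp as_.
apply: (swap_merge (@edgeK D) (@edge_neq D) (resolveK s) (@resolve_neq s)
  (resolveK (a |: s)) E1 E2) => z; exact: resolve_far.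
Qed.

(** This is where planarity enters the cube: the two opposite darts are on
    different circles in exactly one of the two states, so that the edge of the cube
    is a merge or a split, never a map from one circle to one circle. *)
Lemma surgery_connect a s : a \notin s ->
  cn (a |: s) (val a) (opp a) = ~~ cn s (val a) (opp a).
Proof.
move=> as_; have [E1 E2] := resolve_opp as_.
have [chi chk] := diagram_checkerboard D.
have chk_s := checkerboard_resolve s chk.
have chk_t := checkerboard_resolve (a |: s) chk.
apply: (swap_connect (@edgeK D) (@edge_neq D) (resolveK s) (@resolve_neq s)
  (resolveK (a |: s)) E1 E2 _ chk_s chk_t (val_opp a)) => [z|].
  exact: resolve_far.
by rewrite !chk.2 negbK.
Qed.

(** A split is a merge read backwards. *)
Lemma split_circle_glued a s : a \notin s -> cn s (val a) (opp a) ->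
  glued (strand (a |: s)) (strand s) (val a) (opp a).
Proof.
move=> as_ sp; have [E1 E2] := resolve_opp as_.
apply: (swap_merge (@edgeK D) (@edge_neq D) (resolveK (a |: s))
  (@resolve_neq (a |: s)) (resolveK s)) => // [z zE|].
  apply/esym/resolve_far => //; move: zE; rewrite E1 E2.
  by rewrite !inE; do 4!case: eqP.
by rewrite surgery_connect // sp.
Qed.

Lemma surgery_near a s z : a \notin s ->
  near (strand (a |: s)) (val a) (opp a) z = near (strand s) (val a) (opp a) z.
Proof.
move=> as_; have [sp|mg] := boolP (cn s (val a) (opp a)).
  rewrite [RHS]/near !(split_circle_glued as_ sp) /near !connect0 orbT /=.
  by do 2!case: (cn _ _ _).
rewrite [LHS]/near !(merge_glued as_ mg) /near !connect0 orbT /=.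
by do 2!case: (cn _ _ _).
Qed.

Lemma surgery_far a s z u : a \notin s ->
  ~~ near (strand s) (val a) (opp a) z -> cn (a |: s) z u = cn s z u.
Proof.
move=> as_ nz; have [sp|mg] := boolP (cn s (val a) (opp a)).
  by rewrite (split_circle_glued as_ sp) surgery_near // (negPf nz) orbF.
by rewrite (merge_glued as_ mg) (negPf nz) orbF.
Qed.

Lemma card_circles_surgery a s : a \notin s ->
  (#|circles (a |: s)| + ~~ cn s (val a) (opp a) =
   #|circles s| + cn s (val a) (opp a))%N.
Proof.
move=> as_; have [sp|mg] := boolP (cn s (val a) (opp a)).
  have := card_classes_glued (strand_sym _) (strand_sym _) (split_circle_glued as_ sp).
  by rewrite surgery_connect // sp addn0.
have := card_classes_glued (strand_sym _) (strand_sym _) (merge_glued as_ mg).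
by rewrite mg addn0.
Qed.

Lemma eq_circle s x y : (circle_of s x == circle_of s y) = cn s x y.
Proof. by rewrite -val_eqE; apply: eq_class (strand_sym s). Qed.

Lemma circle_ofP s (C : circle s) : exists x, C = circle_of s x.
Proof.
by have /imsetP[x _ E] := valP C; exists x; apply: val_inj; rewrite E.
Qed.

Definition lab s (l : labelling s) (x : dart D) : bool := l (circle_of s x).

Lemma lab_connect s (l : labelling s) x y : cn s x y -> lab l x = lab l y.
Proof. by rewrite -eq_circle /lab => /eqP->. Qed.

Lemma labP s (l l' : labelling s) : (l == l') = [forall x, lab l x == lab l' x].
Proof.
apply/eqP/forallP => [-> //|E]; apply/ffunP => C.
by have [x ->] := circle_ofP C; apply/eqP/E.
Qed.

Definition relabel s (l : labelling s) z g : labelling s :=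
  [ffun C => if C == circle_of s z then g else l C].

Lemma lab_relabel s (l : labelling s) z g x :
  lab (relabel l z g) x = if cn s z x then g else lab l x.
Proof. by rewrite /lab ffunE eq_circle strand_sym. Qed.

Definition all_one s : labelling s := [ffun=> true].

Lemma lab_one s x : lab (all_one s) x.
Proof. by rewrite /lab ffunE. Qed.

Definition agree_away a s t (l : labelling s) (l' : labelling t) :=
  [forall z, ~~ near (strand s) (val a) (opp a) z ==> (lab l z == lab l' z)].

Lemma count_mult (g h k : bool) : (count_mem k (mult g h))%:Z =
  (~~ g + ~~ h == ~~ k :> nat)%N%:R.
Proof. by case: g; case: h; case: k. Qed.

Lemma count_comult (g h k : bool) : (count_mem (h, k) (comult g))%:Z =
  (~~ h + ~~ k == (~~ g).+1)%N%:R.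
Proof. by case: g; case: h; case: k. Qed.

(** Multiplication conserves the number of factors X, and comultiplication
    increases it by one; on basis vectors this determines both. *)
Lemma xi_coefE a s t (l : labelling s) (l' : labelling t) :
    a \notin s -> t = a |: s ->
  xi_coef a l l' = (agree_away a l l' &&
    (if cn s (val a) (opp a)
     then ~~ lab l' (val a) + ~~ lab l' (opp a) == (~~ lab l (val a)).+1
     else ~~ lab l (val a) + ~~ lab l (opp a) == ~~ lab l' (val a))%N)%:R.
Proof.
move=> as_ tE; subst t; rewrite /xi_coef /=.
rewrite (_ : [forall z, _] = agree_away a l l'); last first.
  by apply: eq_forallb => z; rewrite !inE /near negb_or.
rewrite /lab !eq_circle (surgery_connect as_) negbK.
case: agree_away; last by []; rewrite andTb; case: (cn s _ _).
  exact: count_comult.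
exact: count_mult.
Qed.

Lemma natr_andb (b c : bool) : b%:R * c%:R = (b && c)%:R :> int.
Proof. by case: b; rewrite ?mul1r ?mul0r. Qed.

(** N commutes with multiplication by X on the circle through z: both sides are
    the entry at l and l' of the composite with this multiplication. *)
Definition X_linear s t (N : labelling s -> labelling t -> int) :=
  forall l l' z, (lab l z)%:R * N (relabel l z false) l' =
    (~~ lab l' z)%:R * N l (relabel l' z true).

(** Away from the double point, the circle through z is the same in both states.
    Otherwise this is the A-linearity of m, respectively of the comultiplication. *)
Lemma xi_X_linear a s t : a \notin s -> t = a |: s -> X_linear (@xi_coef D a s t).
Proof.
move=> as_ tE l l' z; rewrite !xi_coefE // !natr_andb; congr (nat_of_bool _)%:R.
subst t; have ss := strand_sym s; have st := strand_sym (a |: s).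
have [nz|nz] := boolP (near (strand s) (val a) (opp a) z).
  have E1 : agree_away a (relabel l z false) l' = agree_away a l l'.
    apply: eq_forallb => u; rewrite lab_relabel; case: (boolP (cn s z u)) => // zu.
    by rewrite -(near_connect _ _ ss zu) nz.
  have E2 : agree_away a l (relabel l' z true) = agree_away a l l'.
    apply: eq_forallb => u; rewrite lab_relabel; case: (boolP (cn _ z u)) => // zu.
    by rewrite -!(surgery_near _ as_) -(near_connect _ _ st zu) surgery_near // nz.
  rewrite E1 E2 !lab_relabel.
  rewrite !(andbCA _ (agree_away a l l')); congr (_ && _).
  have [sp|mg] := boolP (cn s (val a) (opp a)).
    have zx : cn s (val a) z.
      by case/orP: nz => // yz; apply: connect_trans yz.
    rewrite (ss z) zx -(lab_connect l zx).
    have nxy : ~~ cn (a |: s) (val a) (opp a) by rewrite surgery_connect // sp.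
    move: nz; rewrite -(surgery_near _ as_) => /orP[] xz.
      rewrite -(lab_connect l' xz) (st z (val a)) xz.
      rewrite -(same_connect st xz) (negPf nxy).
      by case: (lab l _); case: (lab l' _); case: (lab l' _).
    rewrite -(lab_connect l' xz) (st z (opp a)) xz.
    rewrite -(same_connect st xz) (st (opp a)) (negPf nxy).
    by case: (lab l _); case: (lab l' _); case: (lab l' _).
  have zx' : cn (a |: s) z (val a).
    have xy : cn (a |: s) (val a) (opp a) by rewrite surgery_connect.
    move: nz; rewrite -(surgery_near _ as_) st => /orP[] // yz.
    exact: connect_trans xy yz.
  rewrite zx' (lab_connect l' zx').
  case/orP: nz => xz.
    rewrite -(lab_connect l xz) (ss z (val a)) xz.
    rewrite -(same_connect ss xz) (negPf mg).
    by case: (lab l _); case: (lab l _); case: (lab l' _).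
  rewrite -(lab_connect l xz) (ss z (opp a)) xz.
  rewrite -(same_connect ss xz) (ss (opp a)) (negPf mg).
  by case: (lab l _); case: (lab l _); case: (lab l' _).
have zE u : cn (a |: s) z u = cn s z u by apply: surgery_far.
have nzx : cn s z (val a) = false.
  by apply: contraNF nz => zx; rewrite /near ss zx.
have nzy : cn s z (opp a) = false.
  by apply: contraNF nz => zx; rewrite /near (ss (opp a)) zx orbT.
rewrite !lab_relabel !zE nzx nzy !andbA; congr (_ && _).
have agz (m : labelling s) (m' : labelling (a |: s)) u : ~~ near (strand s) (val a) (opp a) u ->
    agree_away a m m' -> lab m u = lab m' u.
  by move=> nu /forallP/(_ u); rewrite nu => /eqP.
apply/andP/andP => -[lz ag].
  have l'z := agz _ _ _ nz ag; rewrite lab_relabel connect0 in l'z; rewrite -l'z.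
  split=> //; apply/forallP => u; apply/implyP => nu; apply/eqP.
  have := agz _ _ _ nu ag; rewrite !lab_relabel zE.
  by case: (boolP (cn s z u)) => // zu _; rewrite -(lab_connect l zu).
have l'z := agz _ _ _ nz ag; rewrite lab_relabel connect0 in l'z; rewrite l'z.
split=> //; apply/forallP => u; apply/implyP => nu; apply/eqP.
have := agz _ _ _ nu ag; rewrite !lab_relabel zE.
case: (boolP (cn s z u)) => // zu _.
have zu' : cn (a |: s) z u by rewrite zE.
by rewrite -(lab_connect l' zu') (negPf lz).
Qed.

(** Every basis vector is obtained from 1 by multiplications by X on circles. *)
Lemma X_linear_eq s t (N N' : labelling s -> labelling t -> int) :
  X_linear N -> X_linear N' -> N (all_one s) =1 N' (all_one s) -> N =2 N'.
Proof.
move=> NX N'X N1 l; have [n] := ubnP #|[set C | ~~ l C]|.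
elim: n l => [l|n IH l]; first by rewrite ltn0.
rewrite ltnS => le_n l'.
have [l1|[C]] := set_0Vmem [set C | ~~ l C].
  have -> // : l = all_one s.
  apply/ffunP => C; rewrite ffunE; apply/negbFE.
  by have := in_set0 C; rewrite -l1 inE.
rewrite inE => lC; have [z Cz] := circle_ofP C.
pose m := relabel l z true.
have mz : lab m z by rewrite lab_relabel connect0.
have lE : l = relabel m z false.
  apply/ffunP => C'; rewrite !ffunE; case: eqP => // ->.
  by rewrite -Cz (negPf lC).
have lt_n : (#|[set C | ~~ m C]| < n)%N.
  apply: leq_trans le_n; apply: proper_card; apply/properP; split.
    by apply/fintype.subsetP => C'; rewrite !inE ffunE; case: ifP.
  by exists C; rewrite !inE // ffunE Cz eqxx.
have := NX m l' z; have := N'X m l' z.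
by rewrite mz !mul1r -lE => -> ->; rewrite IH.
Qed.

Lemma xi_one_merge a s t (l' : labelling t) : a \notin s -> t = a |: s ->
  ~~ cn s (val a) (opp a) -> xi_coef a (all_one s) l' = (l' == all_one t)%:R.
Proof.
move=> as_ tE mg; rewrite xi_coefE // (negPf mg) !lab_one; congr (nat_of_bool _)%:R.
subst t; have st := strand_sym (a |: s).
have xy : cn (a |: s) (val a) (opp a) by rewrite surgery_connect.
apply/andP/eqP => [[ag]|->]; last first.
  by rewrite lab_one; split=> //; apply/forallP => z; rewrite !lab_one implybT.
case l'x: (lab l' (val a)) => // _; apply/eqP; rewrite labP; apply/forallP => z.
rewrite lab_one; have [nz|nz] := boolP (near (strand s) (val a) (opp a) z).
  move: nz; rewrite -(surgery_near _ as_) => /orP[xz|yz].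
    by rewrite -(lab_connect l' xz) l'x.
  by rewrite -(lab_connect l' (connect_trans xy yz)) l'x.
by have := forallP ag z; rewrite nz lab_one eq_sym.
Qed.

Definition one_X s z : labelling s := relabel (all_one s) z false.
Arguments one_X : clear implicits.

Lemma lab_one_X s z u : lab (one_X s z) u = ~~ cn s z u.
Proof. by rewrite lab_relabel lab_one; case: ifP. Qed.

Lemma xi_one_split a s t (l' : labelling t) : a \notin s -> t = a |: s ->
    cn s (val a) (opp a) ->
  xi_coef a (all_one s) l' =
    (l' == one_X t (val a))%:R + (l' == one_X t (opp a))%:R.
Proof.
move=> as_ tE sp; rewrite xi_coefE // sp lab_one.
subst t; have st := strand_sym (a |: s).
have nxy : ~~ cn (a |: s) (val a) (opp a) by rewrite surgery_connect // sp.
have eqE p p' :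
    near (strand s) (val a) (opp a) =1 [pred z | cn (a |: s) p z || cn (a |: s) p' z] ->
    ~~ cn (a |: s) p p' ->
    (l' == one_X (a |: s) p) = [&& agree_away a (all_one s) l', ~~ lab l' p & lab l' p'].
  move=> nE npp'; apply/eqP/and3P => [->|[ag l'p l'p']].
    rewrite !lab_one_X connect0 npp'; split=> //.
    apply/forallP => z; rewrite nE lab_one lab_one_X /= negb_or.
    by case: (cn _ p z); rewrite ?implybT.
  apply/eqP; rewrite labP; apply/forallP => z; rewrite lab_one_X.
  have [nz|nz] := boolP (near (strand s) (val a) (opp a) z).
    move: nz; rewrite nE /= => /orP[pz|p'z].
      by rewrite -(lab_connect l' pz) (negPf l'p) pz.
    rewrite -(lab_connect l' p'z) l'p' (_ : cn _ p z = false) //.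
    by apply: contraNF npp' => pz; apply: connect_trans pz _; rewrite st.
  have := forallP ag z; rewrite nz lab_one /= => /eqP <-.
  by move: nz; rewrite nE /= negb_or => /andP[/negPf->].
rewrite (eqE (val a) (opp a)) // ?(eqE (opp a) (val a)) //; first last.
- by move=> z; rewrite -(surgery_near _ as_).
- by rewrite st.
- by move=> z; rewrite -(surgery_near _ as_) /= orbC.
by case: agree_away; case: (lab l' _); case: (lab l' _).
Qed.

End CircleSurgery.

(** * Commutation of the faces of the cube *)

Lemma sum_transpose (V : zmodType) (T : Type) (w : T -> T -> V) :
    (forall i j, w i j = w j i) -> forall i i' j j',
  w i j + w i j' + (w i' j + w i' j') = w j i + w j i' + (w j' i + w j' i').
Proof. by move=> wC i i' j j'; rewrite addrACA !(wC i) !(wC i'). Qed.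

Lemma splits_arith (n m k : nat) (A B : bool) :
  (n + ~~ A = m + A -> k + ~~ B = n + B -> k + 2 = m + 2 * (A + B))%N.
Proof. by case: A; case: B => /=; lia. Qed.

(** Here n and m are the numbers of circles in the final and in the initial
    state, A and B' tell which maps of the first path are splits, B and A' those of
    the second one, and At whether the arcs at a end up on one circle.  The paths have
    as many splits.  So either each double point is of the same kind on both paths, or
    on both paths the first map is a split and the second one a merge, or on both
    paths it is the other way round. *)
Lemma square_cases (V : Type) (n m : nat) (A B A' B' At : bool) (P P' Q R Z : V) :
    (n + 2 = m + 2 * (A + B'))%N -> (n + 2 = m + 2 * (B + A'))%N ->
    At = ~~ A' -> P = P' ->
    (A -> B -> ~~ B' -> At -> Q = R) -> (~~ A -> B' -> ~~ At -> Q = R) ->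
  (if A then if B' then P else Q else if B' then R else Z) =
  (if B then if A' then P' else R else if A' then Q else Z).
Proof.
move=> nm nm' -> -> QR QR'; move: nm nm' QR QR'.
case: A; case: B; case: A'; case: B' => /= nm nm' QR QR';
  by [reflexivity | rewrite QR | rewrite QR' | lia].
Qed.

Section Squares.
Variable D : diagram.
Implicit Types (x y z p r : dart D) (a b : crossing D) (s t u : {set crossing D}).

Local Notation cn s := (connect (@strand D s)).
Local Notation opp a := (rot (rot (val a : dart D))).

Lemma X_linear_comp s t u (N : labelling s -> labelling t -> int)
    (M : labelling t -> labelling u -> int) :
  X_linear N -> X_linear M ->
  X_linear (fun l l'' => \sum_l' N l l' * M l' l'').
Proof.
move=> NX MX l l'' z; rewrite !mulr_sumr.
transitivity (\sum_(l' | ~~ lab l' z) N l (relabel l' z true) * M l' l'').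
  rewrite [RHS]big_mkcond; apply: eq_bigr => l' _; rewrite mulrA NX.
  by case: (lab l' z); rewrite /= ?mul0r ?mul1r.
transitivity (\sum_(l' | lab l' z) N l l' * M (relabel l' z false) l'').
  rewrite (reindex_onto (fun l' => relabel l' z false) (fun l' => relabel l' z true)).
    rewrite [LHS]big_mkcond [RHS]big_mkcond; apply: eq_bigr => l' _.
    rewrite lab_relabel connect0 /=.
    have -> : (relabel (relabel l' z false) z true == l') = lab l' z.
      rewrite labP; apply/forallP/idP => [/(_ z)|lz w].
        by rewrite lab_relabel connect0 => /eqP <-.
      rewrite !lab_relabel; case: (boolP (cn t z w)) => // zw.
      by rewrite -(lab_connect l' zw) lz.
    case: ifP => // lz; congr (N l _ * _).
    apply/eqP; rewrite labP; apply/forallP => w; rewrite !lab_relabel.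
    by case: (boolP (cn t z w)) => // zw; rewrite -(lab_connect l' zw) lz.
  move=> l' lz; apply/eqP; rewrite labP; apply/forallP => w; rewrite !lab_relabel.
  by case: (boolP (cn t z w)) => // zw; rewrite -(lab_connect l' zw) (negPf lz).
rewrite [LHS]big_mkcond; apply: eq_bigr => l' _; rewrite mulrCA -MX.
by case: (lab l' z); rewrite ?mul1r // mul0r mulr0.
Qed.

(** The coefficients at l of the vectors 1, X_p and X_p X_r, where X_p stands for
    X on the circle through p; the last vector is 0 if p and r are on one circle. *)
Definition delta0 t (l : labelling t) : int := (l == all_one t)%:R.
Definition delta1 t (l : labelling t) p : int := (l == one_X t p)%:R.
Definition delta2 t (l : labelling t) p r : int :=
  (~~ lab l p)%:R * (relabel l p true == one_X t r)%:R.

Lemma delta1E t (l : labelling t) p :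
  (~~ lab l p)%:R * delta0 (relabel l p true) = delta1 l p.
Proof.
rewrite natr_andb; congr (nat_of_bool _)%:R; rewrite !labP.
apply/andP/forallP => [[lp /forallP lE] z|lE].
  have := lE z; rewrite lab_relabel lab_one_X lab_one.
  case: (boolP (cn t p z)) => [pz _|_ /eqP ->//].
  by rewrite -(lab_connect l pz) (negPf lp).
have lp := lE p; rewrite lab_one_X connect0 in lp; split; first by rewrite (eqP lp).
apply/forallP => z; have := lE z; rewrite lab_relabel lab_one lab_one_X.
by case: (cn t p z).
Qed.

Lemma delta1_connect t (l : labelling t) p r : cn t p r -> delta1 l p = delta1 l r.
Proof.
move=> pr; suff E : one_X t p = one_X t r by rewrite /delta1 E.
apply/eqP; rewrite labP; apply/forallP => z; rewrite !lab_one_X.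
by rewrite (same_connect (@strand_sym D t) pr).
Qed.

Lemma delta2E t (l : labelling t) p r : delta2 l p r =
  [&& ~~ lab l p, ~~ lab l r, ~~ cn t p r &
    [forall z, ~~ cn t p z ==> ~~ cn t r z ==> lab l z]]%:R.
Proof.
have st := @strand_sym D t.
rewrite /delta2 natr_andb; congr (nat_of_bool _)%:R; rewrite labP.
case l_p: (lab l p) => //=; apply/forallP/and3P => [lE|[lr npr /forallP lE] z].
  have := lE r; rewrite lab_relabel lab_one_X connect0.
  case: (boolP (cn t p r)) => // npr /eqP lr; rewrite lr; split=> //.
  apply/forallP => z; have := lE z; rewrite lab_relabel lab_one_X.
  by case: (cn t p z); case: (cn t r z) => //= /eqP ->.
rewrite lab_relabel lab_one_X; have := lE z.
case: (boolP (cn t p z)) => [pz _|npz] /=.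
  by apply/eqP/esym; apply: contra npr => rz; apply: connect_trans pz _; rewrite st.
case: (boolP (cn t r z)) => [rz _|_] /=; last by move->.
by rewrite -(lab_connect l rz) (negPf lr).
Qed.

Lemma delta2C t (l : labelling t) p r : delta2 l p r = delta2 l r p.
Proof.
rewrite !delta2E (@strand_sym D t p r); congr (nat_of_bool _)%:R.
rewrite andbCA; congr [&& _, _, _ & _]; apply: eq_forallb => z.
by case: (cn t p z); case: (cn t r z).
Qed.

Lemma xi_one a s t (l : labelling t) : a \notin s -> t = a |: s ->
  xi_coef a (all_one s) l = if cn s (val a) (opp a)
    then delta1 l (val a) + delta1 l (opp a) else delta0 l.
Proof.
move=> as_ tE; case: ifP => [sp|/negbT mg]; first exact: xi_one_split.
exact: xi_one_merge.
Qed.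

Lemma xi_one_X b s t p (l : labelling t) : b \notin s -> t = b |: s ->
  xi_coef b (one_X s p) l = if cn s (val b) (opp b)
    then delta2 l p (val b) + delta2 l p (opp b) else delta1 l p.
Proof.
move=> bs tE; rewrite -[LHS]mul1r -[1]/(true%:R) -(lab_one s p).
rewrite (xi_X_linear bs tE) (xi_one _ bs tE).
by case: ifP => _; [rewrite mulrDr | rewrite delta1E].
Qed.

(** The image of 1 under two edge maps: the product of the factors 1 for a merge
    and X_a + X_a' for a split. *)
Lemma two_steps_one a b s t (l : labelling t) : a \notin s -> b \notin a |: s ->
    t = b |: (a |: s) ->
  \sum_(l' : labelling (a |: s)) xi_coef a (all_one s) l' * xi_coef b l' l =
  if cn s (val a) (opp a) then
    if cn (a |: s) (val b) (opp b) then
      delta2 l (val a) (val b) + delta2 l (val a) (opp b) +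
      (delta2 l (opp a) (val b) + delta2 l (opp a) (opp b))
    else delta1 l (val a) + delta1 l (opp a)
  else if cn (a |: s) (val b) (opp b) then delta1 l (val b) + delta1 l (opp b)
  else delta0 l.
Proof.
move=> as_ bs tE.
have sum1 m : \sum_(l' : labelling (a |: s)) (l' == m)%:R * xi_coef b l' l = xi_coef b m l.
  rewrite (bigD1 m) //= eqxx mul1r big1 ?addr0 // => l' /negPf->.
  by rewrite mul0r.
case A: (cn s (val a) (opp a)).
  under eq_bigr => l' _ do rewrite (xi_one _ as_ (erefl _)) A mulrDl.
  rewrite big_split.
  transitivity (xi_coef b (one_X (a |: s) (val a)) l + xi_coef b (one_X (a |: s) (opp a)) l).
    by congr (_ + _); apply: sum1.
  rewrite !(xi_one_X _ _ bs tE).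
  by case: (cn (a |: s) _ _); reflexivity.
under eq_bigr => l' _ do rewrite (xi_one _ as_ (erefl _)) A.
by rewrite sum1 (xi_one _ bs tE).
Qed.

Lemma merge_connect_sub s a p : a \notin s -> forall r, ~~ cn s (val a) (opp a) ->
  cn s p r -> cn (a |: s) p r.
Proof. by move=> as_ r mg pr; rewrite (merge_glued as_ mg) pr. Qed.

Lemma splits_card a b s : a \notin s -> b \notin a |: s ->
  (#|circles (b |: (a |: s))| + 2 = #|circles s| +
   2 * (cn s (val a) (opp a) + cn (a |: s) (val b) (opp b)))%N.
Proof.
move=> as_ bs.
exact: splits_arith (card_circles_surgery as_) (card_circles_surgery bs).
Qed.

Lemma delta2_sumC t (l : labelling t) p p' r r' :
  delta2 l p r + delta2 l p r' + (delta2 l p' r + delta2 l p' r') =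
  delta2 l r p + delta2 l r p' + (delta2 l r' p + delta2 l r' p').
Proof. exact: sum_transpose (delta2C l) p p' r r'. Qed.

(** The arcs at b lie on one circle before the split at a, and on different ones
    after it.  So b joins the two pieces, and all the darts in question end up on a
    single circle. *)
Lemma delta1_swap_split a b s t (l : labelling t) :
    a \notin s -> b \notin a |: s -> t = b |: (a |: s) ->
    cn s (val a) (opp a) -> cn s (val b) (opp b) ->
    ~~ cn (a |: s) (val b) (opp b) -> cn t (val a) (opp a) ->
  delta1 l (val a) + delta1 l (opp a) = delta1 l (val b) + delta1 l (opp b).
Proof.
move=> as_ bs tE spa spb mgb aa'; subst t; set t := b |: _ in l aa' *.
have st := @strand_sym D t.
have bb' : cn t (val b) (opp b) by rewrite surgery_connect.
have up p r : cn (a |: s) p r -> cn t p r by apply: merge_connect_sub.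
have ab : cn t (val a) (val b).
  move: spb; rewrite (split_circle_glued as_ spa) (negPf mgb) /=.
  case/andP=> /orP[/up//|/up a'b] _; exact: connect_trans aa' a'b.
have a'b' : cn t (opp a) (opp b).
  by rewrite -(same_connect st aa'); apply: connect_trans ab bb'.
exact (f_equal2 +%R (delta1_connect l ab) (delta1_connect l a'b')).
Qed.

(** Two circles are merged at a, and split at b.  As a and a' end up on different
    circles, so do b and b', and these are the same two circles. *)
Lemma delta1_swap_merge a b s t (l : labelling t) :
    a \notin s -> b \notin a |: s -> t = b |: (a |: s) ->
    ~~ cn s (val a) (opp a) ->
    cn (a |: s) (val b) (opp b) -> ~~ cn t (val a) (opp a) ->
  delta1 l (val a) + delta1 l (opp a) = delta1 l (val b) + delta1 l (opp b).
Proof.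
move=> as_ bs tE mga spb naa'; subst t; set t := b |: _ in l naa' *.
have st := @strand_sym D t.
have aa' : cn (a |: s) (val a) (opp a) by rewrite surgery_connect.
move: aa'; rewrite (split_circle_glued bs spb) (negPf naa') /= -/t.
have sep p : cn t p (val a) -> cn t p (opp a) -> False.
  by move=> pa pa'; case/negP: naa'; apply: connect_trans pa'; rewrite st.
case/andP=> /orP[ba|b'a] /orP[ba'|b'a'].
- by case: (sep _ ba ba').
- exact (esym (f_equal2 +%R (delta1_connect l ba) (delta1_connect l b'a'))).
- apply: etrans (addrC _ _) _.
  exact (esym (f_equal2 +%R (delta1_connect l ba') (delta1_connect l b'a))).
- by case: (sep _ b'a b'a').
Qed.

Lemma xi_commute a b s t (l : labelling s) (l'' : labelling t) :
    a != b -> a \notin s -> b \notin s -> t = a |: (b |: s) ->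
  \sum_(l' : labelling (a |: s)) xi_coef a l l' * xi_coef b l' l'' =
  \sum_(l' : labelling (b |: s)) xi_coef b l l' * xi_coef a l' l''.
Proof.
move=> ab as_ bs tE; have tE' : t = b |: (a |: s) by rewrite tE setUCA.
have bas : b \notin a |: s by rewrite !inE negb_or eq_sym ab.
have abs : a \notin b |: s by rewrite !inE negb_or ab.
apply: (X_linear_eq (X_linear_comp (xi_X_linear as_ (erefl _)) (xi_X_linear bas tE'))
  (X_linear_comp (xi_X_linear bs (erefl _)) (xi_X_linear abs tE))) => {l l''} l /=.
rewrite (two_steps_one _ as_ bas tE') (two_steps_one _ bs abs tE).
have card_ab := splits_card as_ bas; have card_ba := splits_card bs abs.
rewrite -tE' in card_ab; rewrite -tE in card_ba.
have aa_t : cn t (val a) (opp a) = ~~ cn (b |: s) (val a) (opp a).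
  by rewrite tE surgery_connect.
exact: (square_cases _ card_ab card_ba aa_t (delta2_sumC l _ _ _ _)
  (delta1_swap_split l as_ bas tE') (delta1_swap_merge l as_ bas tE')).
Qed.

End Squares.

(** * The differential *)

Section Differential.
Variables (D : diagram) (le : rel (crossing D)).
Hypotheses (le_total : total le) (le_anti : antisymmetric le).
Implicit Types (x y z : dart D) (a b c : crossing D) (s t : {set crossing D}).

Local Notation cn s := (connect (@strand D s)).
Local Notation opp a := (rot (rot (val a : dart D))).

Definition cube_sign s a : int := (-1) ^+ #|[set b in s | (b != a) && le a b]|.

Lemma cube_signU1 s a b : a != b -> a \notin s ->
  cube_sign (a |: s) b = (-1) ^+ le b a * cube_sign s b.
Proof.
move=> ab as_; rewrite /cube_sign -exprD; congr (_ ^+ _).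
case ba: (le b a).
  rewrite (_ : [set _ in _ | _] = a |: [set c in s | (c != b) && le b c]).
    by rewrite cardsU1 !inE (negPf as_).
  apply/setP=> c; rewrite !inE; have [->|_] := eqVneq c a => //=.
  by rewrite ab ba.
rewrite add0n; apply: eq_card => c; rewrite !inE.
by have [->|_] := eqVneq c a; rewrite //= ba andbF (negPf as_).
Qed.

(** The sign of the later of the two maps changes exactly when it adds the
    smaller double point; this occurs on one of the two paths. *)
Lemma cube_sign_anti s a b : a != b -> a \notin s -> b \notin s ->
  cube_sign s a * cube_sign (a |: s) b = - (cube_sign s b * cube_sign (b |: s) a).
Proof.
move=> ab as_ bs; rewrite !cube_signU1 // 1?eq_sym //.
have : le a b (+) le b a.
  have := le_total a b; have : ~~ (le a b && le b a).
    by apply: contra ab => /le_anti ->.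
  by case: (le a b); case: (le b a).
rewrite mulrCA [cube_sign s b * _]mulrCA [cube_sign s b * _]mulrC.
by case: (le a b); case: (le b a); rewrite //= ?expr1 ?expr0 ?mulN1r ?mul1r ?opprK.
Qed.

Definition state s (l : labelling s) : generator D :=
  existT (fun t : {set crossing D} => Finite.sort (labelling t)) s l.

Lemma diff_coef_sq (g g'' : generator D) :
  \sum_(g' : generator D) diff_coef le g g' * diff_coef le g' g'' = 0.
Proof.
case: g g'' => s l [s'' l''].
pose C a b := \sum_(l' : labelling (a |: s)) xi_coef a l l' * xi_coef b l' l''.
pose S a b : int := if [&& a \notin s, b \notin a |: s & s'' == b |: (a |: s)]
  then cube_sign s a * cube_sign (a |: s) b * C a b else 0.
have E : \sum_(g' : generator D) diff_coef le (state l) g' *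
    diff_coef le g' (state l'') = \sum_a \sum_b S a b.
  transitivity (\sum_s' \sum_(l' : labelling s')
      diff_coef le (state l) (state l') * diff_coef le (state l') (state l'')).
    rewrite sig_big_dep /=.
    by apply: eq_bigr => -[].
  transitivity (\sum_s' \sum_(a | (a \notin s) && (s' == a |: s))
     \sum_(l' : labelling s') cube_sign s a * xi_coef a l l' *
        diff_coef le (state l') (state l'')).
    apply: eq_bigr => s' _; rewrite exchange_big /=; apply: eq_bigr => l' _.
    by rewrite {1}/diff_coef mulr_suml.
  rewrite (exchange_big_dep (fun a => a \notin s)) /=; last by move=> s' a _ /andP[].
  rewrite [LHS]big_mkcond; apply: eq_bigr => a _.
  case: ifPn => as_; last first.
    by rewrite big1 // => b _; rewrite /S (negPf as_).
  rewrite (big_pred1 (a |: s)); last by move=> s'; rewrite as_.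
  transitivity (\sum_(b | (b \notin a |: s) && (s'' == b |: (a |: s)))
    \sum_(l' : labelling (a |: s)) cube_sign s a * xi_coef a l l' *
      (cube_sign (a |: s) b * xi_coef b l' l'')).
    rewrite exchange_big /=; apply: eq_bigr => l' _.
    by rewrite {1}/diff_coef mulr_sumr.
  rewrite [LHS]big_mkcond; apply: eq_bigr => b _; rewrite /S as_ /=.
  by case: ifP => // _; rewrite /C mulr_sumr; apply: eq_bigr => l' _; rewrite mulrACA.
rewrite E; 
(* Exchange the two double points. *)
have anti : \sum_a \sum_b S a b = - \sum_a \sum_b S a b.
  rewrite [LHS]exchange_big /= -sumrN; apply: eq_bigr => a _.
  rewrite -sumrN; apply: eq_bigr => b _; rewrite /S.
  have [<-|ab] := eqVneq b a; first by rewrite setU11 !andbF oppr0.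
  have cE : [&& b \notin s, a \notin b |: s & s'' == a |: (b |: s)] =
      [&& a \notin s, b \notin a |: s & s'' == b |: (a |: s)].
    rewrite !inE !negb_or (eq_sym a b) ab /= setUCA.
    by case: (a \in s); case: (b \in s).
  rewrite cE; case: and3P => [[as_ bas /eqP s''E]|_]; last first.
    by rewrite oppr0.
  rewrite -mulNr.
  have bs : b \notin s by move: bas; rewrite !inE negb_or => /andP[].
  rewrite (cube_sign_anti ab bs as_); congr (_ * _).
  by apply: xi_commute => //; rewrite s''E setUCA.
by move: anti; lia.
Qed.

(** Labels are attached here to sets of darts, which makes the circles common to
    two states comparable. *)
Definition circle_lab s (l : labelling s) (A : {set dart D}) : bool :=
  if [pick z in A] is Some z then lab l z else true.

Lemma circle_sum s (l : labelling s) x y :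
  \sum_(C : circle s) gen_deg (l C) =
  gen_deg (lab l x) + (if cn s x y then 0 else gen_deg (lab l y)) +
  \sum_(A in far_classes (@strand D s) x y) gen_deg (circle_lab l A).
Proof.
have lE (z : dart D) : circle_lab l [set w | cn s z w] = lab l z.
  rewrite /circle_lab; case: pickP => [w|/(_ z)]; last by rewrite inE connect0.
  by rewrite inE => zw; rewrite (lab_connect l zw).
transitivity (\sum_(A in circles s) gen_deg (circle_lab l A)).
  rewrite [RHS](reindex_omap (val : circle s -> {set dart D}) insub) => [|A As]; last first.
    by rewrite insubT.
  apply: eq_big => [C|C _]; first by rewrite valK eqxx (valP C).
  by have [z ->] := circle_ofP C; rewrite lE.
have sym := @strand_sym D s.
rewrite -[circles s]/(classes (strand s)) (classesD x y sym).
have [xy|nxy] := boolP (cn s x y).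
  have -> : [set z | cn s y z] = [set z | cn s x z].
    by apply/eqP; rewrite eq_class // sym.
  rewrite setUA setUid big_setU1 /= ?lE ?addr0 //.
  by rewrite !inE connect0 andbF.
rewrite big_setU1 /=; last by rewrite !inE eq_class // (negPf nxy) connect0 andbF.
rewrite big_setU1 /= ?lE ?addrA //.
by rewrite !inE connect0 !andbF.
Qed.

(** A label contributes 1 - 2n to the degree, n being its number of factors X. *)
Lemma xi_degree a s t (l : labelling s) (l' : labelling t) :
  a \notin s -> t = a |: s -> xi_coef a l l' != 0 ->
  \sum_(C : circle s) gen_deg (l C) = \sum_(C : circle t) gen_deg (l' C) + 1.
Proof.
move=> as_ tE; rewrite xi_coefE //; case: (boolP (_ && _)) => // /andP[ag par] _.
subst t; rewrite (circle_sum l (val a) (opp a)) (circle_sum l' (val a) (opp a)).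
have farE : far_classes (@strand D (a |: s)) (val a) (opp a) =
    far_classes (@strand D s) (val a) (opp a).
  have [sp|mg] := boolP (cn s (val a) (opp a)).
    by rewrite (far_classes_glued (@strand_sym _ _) (split_circle_glued as_ sp)).
  by rewrite (far_classes_glued (@strand_sym _ _) (merge_glued as_ mg)).
rewrite farE surgery_connect //.
rewrite [X in _ + X = _](_ : _ = \sum_(A in far_classes (@strand D s) (val a) (opp a))
    gen_deg (circle_lab l' A)); last first.
  apply: eq_bigr => A; rewrite inE => /andP[/imsetP[z _ ->]].
  rewrite !inE => /andP[zx zy]; congr gen_deg; rewrite /circle_lab.
  case: pickP => // w; rewrite inE => zw.
  have := forallP ag w; rewrite /near !(@strand_sym D s _ w).
  rewrite -!(same_connect (@strand_sym D s) zw).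
  by rewrite (negPf zx) (negPf zy) => /eqP.
move: (\sum_(A in _) _) par => F.
case: (cn s _ _); rewrite /= /gen_deg.
  by case: (lab l _); case: (lab l' _); case: (lab l' _) => //= _; lia.
by case: (lab l _); case: (lab l _); case: (lab l' _) => //= _; lia.
Qed.

Lemma diff_coef_degree (g g' : generator D) : diff_coef le g g' != 0 ->
  height g' = height g + 1 /\ degree g' = degree g.
Proof.
case: g g' => s l [t l'] nz.
have [a /and3P[as_ /eqP tE xi]] : exists a, [&& a \notin s, t == a |: s & xi_coef a l l' != 0].
  apply/existsP; apply: contraNT nz; rewrite negb_exists => /forallP nz.
  rewrite /diff_coef big1 //= => a /andP[as_ tE]; have := nz a.
  by rewrite as_ tE negbK => /eqP->; rewrite mulr0.
have ct : #|t| = #|s|.+1 by rewrite tE cardsU1 as_.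
rewrite /degree /height /= (xi_degree as_ tE xi) ct -addn1 PoszD.
by split=> //; rewrite -addrA [1 + _]addrC.
Qed.

Lemma cube_diff_sq (i k m j : int) (v : {ffun @cube_basis D i j -> int}) : k = i + 1 ->
  cube_diff le m (cube_diff le k v) = 0.
Proof.
move=> kE; apply/ffunP => g''; rewrite !ffunE.
transitivity (\sum_(g' : @cube_basis D k j) \sum_(g : @cube_basis D i j)
   v g * (diff_coef le (val g) (val g') * diff_coef le (val g') (val g''))).
  apply: eq_bigr => g' _; rewrite ffunE mulr_sumr; apply: eq_bigr => g _.
  by rewrite mulrC mulrAC mulrC.
rewrite exchange_big big1 //= => g _; rewrite -mulr_sumr.
suff -> : \sum_(g' : @cube_basis D k j) diff_coef le (val g) (val g') *
    diff_coef le (val g') (val g'') = 0 by rewrite mulr0.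
rewrite -[RHS](diff_coef_sq (val g) (val g'')).
transitivity (\sum_(g' : generator D | (height g' == k) && (degree g' == j))
    diff_coef le (val g) g' * diff_coef le g' (val g'')).
  rewrite [RHS](reindex_omap (val : @cube_basis D k j -> generator D) insub).
    by apply: eq_bigl => g'; rewrite valK eqxx (valP g').
  by move=> g' bg'; rewrite insubT.
rewrite [LHS]big_mkcond; apply: eq_bigr => g' _; case: ifP => // /negP nb.
have [->|/diff_coef_degree[hE dE]] := eqVneq (diff_coef le (val g) g') 0.
  by rewrite mul0r.
case: nb; rewrite hE dE kE.
by have /andP[/eqP-> /eqP->] := valP g; rewrite !eqxx.
Qed.

End Differential.

Lemma differential_sq (D : oriented_diagram) (le : rel (crossing D)) :
    total le -> antisymmetric le -> forall (i k m j : int) (v : cochain D i j),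
    k = i + 1 ->
  differential le m (differential le k v) = 0.
Proof.
move=> le_total le_anti i k m j v kE.
rewrite {2}/differential raddfMz /= /differential.
rewrite (@cube_diff_sq D le le_total le_anti) ?mul0rz // kE.
by rewrite addrAC.
Qed.

(** * The dimension of rational cohomology *)

Section ElementaryTensors.
Variables (G : zmodType) (W : vectType rat) (t : G -> rat -> W).
Hypothesis tP : is_tensorQ t.

Lemma zmod_morphismMz (U V : zmodType) (f : U -> V) (n : int) :
  zmod_morphism f -> {morph f : x / x *~ n}.
Proof.
move=> fB x; pose phi : {additive U -> V} := HB.pack f (GRing.isZmodMorphism.Build U V f fB).
exact: (raddfMz phi).
Qed.

Lemma zmod_morphism0 (U V : zmodType) (f : U -> V) : zmod_morphism f -> f 0 = 0.
Proof. by move=> fB; rewrite -[0 in LHS](subrr 0) fB subrr. Qed.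

Lemma tensor_int x r (n : int) : t x (r *~ n) = t (x *~ n) r.
Proof.
have [tB tB'] := tensorQ_biadditive tP.
by rewrite (zmod_morphismMz n (tB x)) (zmod_morphismMz n (tB' r)).
Qed.

Definition elementary : {pred W} := fun w => `[< exists x r, w = t x r >].

Lemma elementary_zmod : zmod_closed elementary.
Proof.
have [tB tB'] := tensorQ_biadditive tP.
split=> [|w w']; rewrite !unfold_in.
  by apply/asboolP; exists 0, 0; rewrite (zmod_morphism0 (tB 0)).
move=> /asboolP[x [r ->]] /asboolP[x' [r' ->]]; apply/asboolP.
pose d : rat := ((denq r)%:~R * (denq r')%:~R)^-1.
have dr : (denq r)%:~R != 0 :> rat by rewrite intr_eq0 denq_neq0.
have dr' : (denq r')%:~R != 0 :> rat by rewrite intr_eq0 denq_neq0.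
exists (x *~ (numq r * denq r') - x' *~ (numq r' * denq r)), d.
have frac (a b c : rat) : b != 0 -> c != 0 -> a / b = (b * c)^-1 * (a * c).
  by move=> b0 c0; rewrite invfM mulrACA mulVf // mulr1 mulrC.
rewrite tB' -!tensor_int; congr (t x _ - t x' _); rewrite -mulrzr intrM /d.
  by rewrite -frac // divq_num_den.
by rewrite [_ * (denq r')%:~R]mulrC -frac // divq_num_den.
Qed.

HB.instance Definition _ := GRing.isZmodClosed.Build W elementary elementary_zmod.

(** Elementary tensors form a subgroup, as two of them can be given a common
    denominator.  The projection onto the quotient by this subgroup and the zero map
    agree on elementary tensors, hence are equal by the uniqueness part of the
    universal property. *)
Lemma elementaryP w : exists x r, w = t x r.
Proof.
pose Q : zmodType := Quotient.quot elementary.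
pose p : {additive W -> Q} := \pi_Q%qT.
have b0 : biadditive (fun (_ : G) (_ : rat) => 0 : Q).
  by split=> x y z; rewrite subrr.
have [h _ h_uniq] := tensorQ_universal tP b0.
have zB : zmod_morphism (fun _ : W => 0 : Q) by move=> x y; rewrite subrr.
pose z : {additive W -> Q} :=
  HB.pack (fun _ : W => 0 : Q) (GRing.isZmodMorphism.Build W Q _ zB).
have pE : p w = 0.
  rewrite (h_uniq p) => [|x r].
    by rewrite -(h_uniq z).
  apply/eqP; rewrite -(raddf0 p) /p /= -Quotient.idealrBE subr0 unfold_in.
  by apply/asboolP; exists x, r.
apply/asboolP; move/eqP: pE.
by rewrite -(raddf0 p) /p /= -Quotient.idealrBE subr0 unfold_in.
Qed.

End ElementaryTensors.

Section IntegerMaps.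

Definition ratv (I : finType) (v : {ffun I -> int}) : 'rV[rat]_#|I| :=
  \row_i (v (enum_val i))%:~R.

Definition basis_ffun (I : finType) (i : I) : {ffun I -> int} :=
  [ffun k => (k == i)%:R].

Definition rat_mx (I J : finType) (f : {ffun I -> int} -> {ffun J -> int}) :
    'M[rat]_(#|I|, #|J|) :=
  \matrix_(i, j) (f (basis_ffun (enum_val i)) (enum_val j))%:~R.

Lemma ratv_zmod (I : finType) : zmod_morphism (@ratv I).
Proof. by move=> v w; apply/rowP => i; rewrite !mxE !ffunE intrB. Qed.

Lemma ratv_inj (I : finType) : injective (@ratv I).
Proof.
move=> v w /rowP E; apply/ffunP => i; have := E (enum_rank i).
by rewrite !mxE enum_rankK => /intr_inj.
Qed.

Lemma ratv_mx (I J : finType) (f : {additive {ffun I -> int} -> {ffun J -> int}})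
  (v : {ffun I -> int}) : ratv (f v) = ratv v *m rat_mx f.
Proof.
have vE : v = \sum_i basis_ffun i *~ v i.
  apply/ffunP => k; rewrite sum_ffunE (bigD1 k) //= big1 => [|i ik].
    by rewrite addr0 ffunMzE ffunE eqxx -mulrzr mul1r intz.
  by rewrite ffunMzE ffunE eq_sym (negPf ik) mul0rz.
rewrite {1}vE raddf_sum; apply/rowP => j; rewrite !mxE sum_ffunE rmorph_sum /=.
rewrite (reindex (@enum_val I predT)) /=; last first.
  by exists enum_rank => i _; rewrite ?enum_valK ?enum_rankK.
apply: eq_bigr => i _; rewrite !mxE raddfMz ffunMzE.
by rewrite -[X in X%:~R = _]mulrzr intz intrM mulrC.
Qed.

Lemma clear_denominators (I : finType) (u : 'rV[rat]_#|I|) :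
  exists2 n : int, n != 0 & exists v, ratv v = n%:~R *: u.
Proof.
pose n := \prod_i denq (u 0 i).
exists n; first by apply/prodf_neq0 => i _; apply: denq_neq0.
exists [ffun k => numq (u 0 (enum_rank k)) *
  \prod_(i | i != enum_rank k) denq (u 0 i)].
apply/rowP => i; rewrite !mxE ffunE enum_valK /n.
rewrite [X in _ = X%:~R * _](bigD1 i) //= !intrM.
by rewrite numqE [RHS]mulrC mulrA.
Qed.

End IntegerMaps.

Section CohomologyDim.
Variables (I J K : finType).
Variables (f : {additive {ffun I -> int} -> {ffun J -> int}}).
Variables (g : {additive {ffun J -> int} -> {ffun K -> int}}).
Hypothesis gf0 : forall u, g (f u) = 0.

Let F := rat_mx f.
Let G := rat_mx g.

Lemma rat_mx_comp0 : F *m G = 0.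
Proof.
apply/row_matrixP => i; rewrite row_mul row0.
have -> : row i F = ratv (f (basis_ffun (enum_val i))).
  by apply/rowP => j; rewrite !mxE.
by rewrite -ratv_mx gf0; apply: zmod_morphism0 (@ratv_zmod K).
Qed.

Let U := (kermx G :\: F)%MS.
Let V : 'M[rat]_#|J| := <<F>>%MS.

(** Coordinates in a complement U of the image of F inside the kernel of G. *)
Let M : 'M[rat]_(#|J|, \rank U) := proj_mx U V *m pinvmx (row_base U).

Let UV0 : (U :&: V)%MS = 0.
Proof.
apply/eqP; rewrite -submx0; rewrite -(capmx_diff (kermx G) F).
by rewrite capmxS // genmxE.
Qed.

Let FM0 : F *m M = 0.
Proof. by rewrite mulmxA (proj_mx_0 UV0) ?genmxE // mul0mx. Qed.

Let M_inj m (v : 'M[rat]_(m, #|J|)) : v *m G = 0 -> v *m M = 0 -> (v <= F)%MS.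
Proof.
move=> vG vM; have vk : (v <= kermx G)%MS by apply/sub_kermxP.
have vUV : (v <= U + V)%MS.
  apply: submx_trans vk _; rewrite -(addsmx_diff_cap_eq (kermx G) F).
  by rewrite addsmxS // genmxE capmxSr.
have vU0 : v *m proj_mx U V = 0.
  have sub : (v *m proj_mx U V <= row_base U)%MS.
    by rewrite eq_row_base proj_mx_sub.
  by rewrite -(mulmxKpV sub) -(mulmxA v) vM mul0mx.
have := add_proj_mx UV0 vUV; rewrite vU0 add0r => <-.
by apply: submx_trans (proj_mx_sub _ _ _) _; rewrite genmxE.
Qed.

Let M_surj (w : 'rV[rat]_(\rank U)) : exists2 v, v *m G = 0 & v *m M = w.
Proof.
have sub : (w *m row_base U <= U)%MS.
  by apply: submx_trans (submxMl _ _) _; rewrite eq_row_base.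
exists (w *m row_base U).
  by apply/sub_kermxP; apply: submx_trans sub (diffmxSl _ _).
rewrite mulmxA (proj_mx_id UV0 sub) -mulmxA mulmxVp ?mulmx1 //.
exact: row_base_free.
Qed.

Let rankU : (\rank U + \rank F + \rank G = #|J|)%N.
Proof.
have FG : (F <= kermx G)%MS by apply/sub_kermxP/rat_mx_comp0.
have := mxrank_cap_compl (kermx G) F; rewrite (capmx_idPr FG) mxrank_ker -/U.
by have := rank_leq_row G; lia.
Qed.

Local Notation H := (cohomology f g).
Local Notation cob := (@is_coboundary _ _ _ f g).

Let piH : {additive cocycle g -> H} := \pi_(Quotient.quot cob)%qT.

Let coord (z : H) : 'rV[rat]_(\rank U) := ratv (val (repr z)) *m M.

Let coord_pi (c : cocycle g) : coord (piH c) = ratv (val c) *m M.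
Proof.
apply/eqP; rewrite -subr_eq0 -mulmxBl -ratv_zmod.
have : repr (piH c) - c \in cob.
  by rewrite Quotient.idealrBE reprK.
rewrite unfold_in => /asboolP[u E].
have -> : val (repr (piH c)) - val c = f u by rewrite E raddfB.
by rewrite ratv_mx -mulmxA FM0 mulmx0.
Qed.

Let coord_zmod : zmod_morphism coord.
Proof.
move=> z z'; rewrite -[z]reprK -[z']reprK -!/(piH _) -raddfB !coord_pi.
by rewrite -mulmxBl -ratv_zmod raddfB.
Qed.

(** The universal property turns z (x) r |-> r * coord z into a linear map from
    W to the coordinate space.  It is onto because rational cocycles have integral
    multiples.  It is injective because all tensors are elementary, and because a
    cocycle that bounds rationally has a nonzero multiple that bounds integrally, so
    that its class is killed by the tensor product. *)
Lemma cohomology_dim (W : vectType rat) (t : H -> rat -> W) : is_tensorQ t ->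
  (\dim {:W} + \rank F + \rank G = #|J|)%N.
Proof.
move=> tP; rewrite -[RHS]rankU; congr (_ + _ + _)%N.
pose b (z : H) (r : rat) := r *: coord z.
have bP : biadditive b.
  split=> [z r r'|r z z']; first exact: scalerBl.
  by rewrite /b coord_zmod scalerBr.
have [h hE _] := tensorQ_universal tP bP.
have hlin : scalable h := rat_linear (raddfB h).
pose h' : {linear W -> 'rV[rat]_(\rank U)} :=
  HB.pack (h : W -> 'rV[rat]_(\rank U))
    (GRing.isZmodMorphism.Build _ _ _ (raddfB h))
    (GRing.isScalable.Build _ _ _ _ _ hlin).
have h_inj w : h w = 0 -> w = 0.
  have [z [r ->]] := elementaryP tP w; rewrite hE /b => /eqP.
  have [tB tB'] := tensorQ_biadditive tP.
  rewrite scaler_eq0 => /orP[/eqP->|/eqP]; first exact: zmod_morphism0 (tB z).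
  rewrite -[z]reprK -/(piH _); set c := repr z; rewrite coord_pi => cM.
  have cG : ratv (val c) *m G = 0.
    rewrite -ratv_mx; have := valP c; rewrite unfold_in => /eqP->.
    exact: zmod_morphism0 (@ratv_zmod K).
  have /submxP[u cE] := M_inj cG cM.
  have [n n0 [v vE]] := clear_denominators u.
  have nc : c *~ n \in cob.
    rewrite unfold_in; apply/asboolP; exists v; apply: ratv_inj.
    rewrite ratv_mx vE -scalemxAl -cE raddfMz (zmod_morphismMz _ (@ratv_zmod J)).
    by rewrite scaler_int.
  have piN : piH c *~ n = 0.
    rewrite -raddfMz; apply/eqP; rewrite -(raddf0 piH).
    by rewrite /piH /= -Quotient.idealrBE subr0.
  have n0' : n%:~R != 0 :> rat by rewrite intr_eq0.
  have -> : r = (r / n%:~R) *~ n by rewrite -mulrzr mulfVK.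
  by rewrite (tensor_int tP) piN; apply: zmod_morphism0 (tB' _).
have h_surj w : exists x, h x = w.
  have [v vG vM] := M_surj w.
  have [n n0 [v' v'E]] := clear_denominators v.
  have v'P : v' \in is_cocycle g.
    rewrite unfold_in; apply/eqP/ratv_inj; rewrite ratv_mx v'E -scalemxAl vG scaler0.
    exact/esym/zmod_morphism0/(@ratv_zmod K).
  exists (t (piH (Cocycle v'P)) n%:~R^-1).
  rewrite hE /b coord_pi /= v'E -scalemxAl vM scalerA mulVf ?scale1r //.
  by rewrite intr_eq0.
have ker0 : lker (linfun h') = 0%VS.
  by apply/eqP/lker0P => x y; rewrite !lfunE /= => E; apply/eqP; rewrite -subr_eq0;
     apply/eqP/h_inj; rewrite raddfB E subrr.
rewrite -(limg_dim_eq (f := linfun h')) ?ker0 ?capv0 //.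
have -> : (linfun h' @: fullv = fullv)%VS.
  apply/vspaceP => w; rewrite memvf; have [x <-] := h_surj w.
  by rewrite -[h x]/(h' x) -(lfunE h') memv_img ?memvf.
by rewrite dimvf /dim /= mul1n.
Qed.

End CohomologyDim.

(** * Euler characteristics *)

Section EulerCharacteristic.
Variables (F : fieldType) (a : F) (T : finType) (ht : T -> nat) (dg : T -> int).
Variables (N : nat) (x sh : int) (d rho : int -> int -> nat).
Hypothesis ht_le : forall g, (ht g <= N)%N.
Let cell i j g := ((ht g)%:Z == i + x) && (dg g == j + sh).
Hypothesis rank_nullity : forall i j,
  (d i j + rho (i - 1) j + rho i j)%N = #|[pred g | cell i j g]|.

(** A finite set of bidegrees containing all those of elements of T. *)
Definition box : seq (int * int) :=
  [seq (i, j) | i <- [seq k%:Z - x | k <- iota 0 N.+1],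
                j <- undup [seq dg g - sh | g <- enum T]].

Lemma box_uniq : uniq box.
Proof.
apply: allpairs_uniq => [||[i j] [i' j'] _ _ [-> ->]] //; last exact: undup_uniq.
rewrite map_inj_uniq ?iota_uniq // => k k' /addIr; by case.
Qed.

Lemma cell_box i j g : cell i j g -> (i, j) \in box.
Proof.
case/andP=> /eqP hE /eqP dE; apply: allpairs_f.
  apply/mapP; exists (ht g); last by rewrite hE addrK.
  by rewrite mem_iota add0n ltnS ht_le.
rewrite mem_undup; apply/mapP; exists g; first by rewrite mem_enum.
by rewrite dE addrK.
Qed.

Lemma cell_empty i j : (i, j) \notin box -> #|[pred g | cell i j g]| = 0%N.
Proof.
move=> nb; apply: eq_card0 => g; rewrite !inE.
by apply: contraNF nb; apply: cell_box.
Qed.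

Lemma cell_height i j : (i + x < 0) || (N%:Z < i + x) ->
  #|[pred g | cell i j g]| = 0%N.
Proof.
move=> out; apply: eq_card0 => g; rewrite !inE; apply/negP => /andP[/eqP hE _].
by move: out; rewrite -hE; have := ht_le g; lia.
Qed.

(** The rank of every differential occurs twice, with opposite signs. *)
Lemma rank_alternating_sum j :
  \sum_(i <- [seq k%:Z - x | k <- iota 0 N.+1])
    (-1) ^ i * ((rho (i - 1) j)%:R + (rho i j)%:R) = 0 :> F.
Proof.
pose f (k : nat) : F := (-1) ^ (k%:Z - 1 - x) * (rho (k%:Z - 1 - x) j)%:R.
have m1 : (-1 : F) != 0 by rewrite oppr_eq0 oner_eq0.
rewrite big_map -[iota 0 N.+1]/(index_iota 0 N.+1).
transitivity (\sum_(0 <= k < N.+1) (f k.+1 - f k)).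
  apply: eq_bigr => k _; rewrite /f.
  have -> : k.+1%:Z - 1 - x = k%:Z - x by lia.
  have -> : k%:Z - 1 - x = k%:Z - x - 1 by lia.
  rewrite (expfzDr _ (-1) m1) exprN1 invrN1 mulrN1 mulNr opprK.
  by rewrite mulrDr [RHS]addrC.
rewrite telescope_sumr // /f.
have -> : rho (N.+1%:Z - 1 - x) j = 0%N.
  have := rank_nullity (N.+1%:Z - x) j; rewrite cell_height; last by lia.
  have -> : N.+1%:Z - x - 1 = N.+1%:Z - 1 - x by lia.
  by lia.
have -> : rho (0%:Z - 1 - x) j = 0%N.
  by have := rank_nullity (0%:Z - 1 - x) j; rewrite cell_height; lia.
by rewrite !mulr0 subrr.
Qed.

Lemma euler_characteristic :
  \sum_(ij <- box) (-1) ^ ij.1 * a ^ ij.2 * (d ij.1 ij.2)%:R =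
  \sum_g (-1) ^ ((ht g)%:Z - x) * a ^ (dg g - sh).
Proof.
transitivity (\sum_(ij <- box) (-1) ^ ij.1 * a ^ ij.2 *
    (#|[pred g | cell ij.1 ij.2 g]|%:R : F)).
  apply/esym/eqP; rewrite -subr_eq0 -sumrB; apply/eqP.
  rewrite big_allpairs_dep /= exchange_big /= big1 // => j _.
  have := congr1 ( *%R (a ^ j)) (rank_alternating_sum j).
  rewrite mulr0 mulr_sumr => E; rewrite -[RHS]E.
  apply: eq_bigr => i _; rewrite -mulrBr -rank_nullity !natrD.
  have drop (u v w : F) : u + v + w - u = v + w by rewrite [LHS]addrC !addrA addNr add0r.
  by rewrite drop mulrA [a ^ j * _]mulrC.
transitivity (\sum_(ij <- box) \sum_(g | cell ij.1 ij.2 g)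
    (-1) ^ ((ht g)%:Z - x) * a ^ (dg g - sh)).
  apply: eq_bigr => -[i j] _ /=; rewrite -sumr_const mulr_sumr.
  apply: eq_big => // g; rewrite !inE => /andP[/eqP-> /eqP->].
  by rewrite !addrK mulr1.
rewrite (exchange_big_dep xpredT) //=; apply: eq_bigr => g _.
rewrite (eq_bigl (pred1 ((ht g)%:Z - x, dg g - sh))); last first.
  case=> i j; rewrite /cell /= xpair_eqE.
  by rewrite ![_ == _ - _]eq_sym !subr_eq.
rewrite -big_filter filter_pred1_uniq ?big_seq1 ?box_uniq //.
by apply: (@cell_box _ _ g); rewrite /cell !subrK !eqxx.
Qed.

End EulerCharacteristic.

Section GradedDimension.
Variables (F : fieldType) (a : F) (D : prediagram).
Hypothesis a0 : a != 0.

(** The factor A of a circle has graded dimension a + a^-1, and the shift by |s|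
    of the degree contributes a^|s|. *)
Lemma graded_dimension : \sum_(g : generator D) (-1) ^+ #|tag g| * a ^ degree g =
  \sum_(s : {set crossing D}) (- a) ^+ #|s| * (a + a^-1) ^+ #|circles s|.
Proof.
transitivity (\sum_s \sum_(l : @labelling D s)
   (- a) ^+ #|s| * \prod_(C : circle s) a ^ gen_deg (l C)).
  rewrite sig_big_dep /=; apply: eq_bigr => -[s l] _ /=.
  have -> : \prod_(C : circle s) a ^ gen_deg (l C) = a ^ (\sum_(C : circle s) gen_deg (l C)).
    by elim/big_rec2: _ => [|C y z _ ->]; rewrite ?expr0z ?expfzDr.
  by rewrite /degree /= expfzDr // [(- a) ^+ _]exprNn -mulrA [a ^+ _ * _]mulrC.
apply: eq_bigr => s _; rewrite -mulr_sumr; congr (_ * _).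
rewrite -(bigA_distr_bigA (fun (C : circle s) (b : bool) => a ^ gen_deg b)).
under eq_bigr => C _ do rewrite big_bool /= expr1z exprN1.
by rewrite prodr_const card_sig.
Qed.

End GradedDimension.

From mathcomp Require Import classical_sets fsbigop.

Section Support.
Variables (F : fieldType) (a : F) (T : finType) (ht : T -> nat) (dg : T -> int).
Variables (N x : nat) (sh : int) (d rho : int -> int -> nat).
Hypothesis a0 : a != 0.
Hypothesis ht_le : forall g, (ht g <= N)%N.
Hypothesis rank_nullity : forall i j, (d i j + rho (i - 1) j + rho i j)%N =
  #|[pred g | ((ht g)%:Z == i + x%:Z) && (dg g == j + sh)]|.

Lemma euler_characteristic_support :
  \sum_(ij \in [set: int * int]%classic)
    (-1) ^ ij.1 * a ^ ij.2 * (d ij.1 ij.2)%:R =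
  (-1) ^+ x * a ^ (- sh) * \sum_g (-1) ^+ ht g * a ^ dg g.
Proof.
rewrite (fsbigE (box dg N x sh)) //; first last.
- case=> i j _ out /=; have := rank_nullity i j.
  rewrite (cell_empty ht_le out) => /eqP; rewrite -addnA addn_eq0 => /andP[/eqP-> _].
  exact: mulr0.
- exact: box_uniq.
rewrite (eq_bigl xpredT); last by move=> ij; rewrite in_setT.
rewrite (euler_characteristic a ht_le rank_nullity) mulr_sumr.
have m1 : (-1 : F) != 0 by rewrite oppr_eq0 oner_eq0.
apply: eq_bigr => g _; rewrite !expfzDr // -[(-1) ^ (- _)]exprz_inv invrN1.
by rewrite [RHS]mulrACA; congr (_ * _); apply: mulrC.
Qed.

End Support.

Theorem proposition27
    (br : diagram -> qfrac) (br_bracket : is_kauffman_bracket br)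
    (D : oriented_diagram)
    (le : rel (crossing D))
    (le_total : total le) (le_trans : transitive le)
    (le_anti : antisymmetric le)
    (HQ : int -> int -> vectType rat)
    (tensor : forall i j : int, Khovanov le i j -> rat -> HQ i j)
    (HQ_tensor : forall i j : int, is_tensorQ (tensor i j)) :
  scaled_bracket br D =
    \sum_(ij \in [set: int * int]%classic)
      (-1) ^ ij.1 * q ^ ij.2 * (\dim {:HQ ij.1 ij.2})%:R.
Proof.
pose rho i j : nat := \rank (@rat_mx _ _ (@differential D le i (i + 1) j)).
pose sh := (2 * nneg D)%:Z - (npos D)%:Z.
have rank_nullity i j : (\dim {:HQ i j} + rho (i - 1)%R j + rho i j)%N =
    #|[pred g : generator D | ((#|tag g|)%:Z == i + (nneg D)%:Z) &&
        (degree g == j + sh)]|.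
  have sq (u : cochain D (i - 1) j) :
      differential le (i + 1) (differential le i u) = 0 :> cochain D (i + 1) j.
    by apply: (differential_sq le_total le_anti); rewrite subrK.
  have := @cohomology_dim _ _ _ (@differential D le (i - 1) i j)
    (@differential D le i (i + 1) j) sq _ _ (HQ_tensor i j).
  have -> : \rank (rat_mx (@differential D le (i - 1) i j)) = rho (i - 1) j.
    by rewrite /rho subrK.
  rewrite -/(rho i j) => ->; rewrite card_sig; apply: eq_card => g.
  by rewrite !inE.
rewrite (@euler_characteristic_support _ q _ (fun g : generator D => #|tag g|) _
  #|crossing D| _ sh _ rho q_neq0 _ rank_nullity); last by move=> g; apply: max_card.
rewrite (graded_dimension D q_neq0) /scaled_bracket (bracket_state_sum br_bracket).
by rewrite opprB.
Qed.
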